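(* Let $(\Omega,\mu)$ be an atomless finite measure space and let $p(\cdot)$ be an exponent on $\Omega$ with $p(t)>1$ for $\mu$-a.e. $t\in\Omega$. The following are equivalent: (1) $\int_0^{\mu(\Omega)} a^{\left(\frac{p}{p-1}\right)^*(x)}\,dx<\infty$ for every $a>1$. (2) The inclusion $L^{p(\cdot)}(\mu)\hookrightarrow L^1(\mu)$ is weakly compact. (3) The inclusion $L^{p(\cdot)}(\mu)\hookrightarrow L^1(\mu)$ is disjointly strictly singular. (4) $\lim_{x\to\mu(\Omega)^-}(\mu(\Omega)-x)^{\left(\frac{p-1}{p}\right)^*(x)}=0$.
   Context: An exponent on $\Omega$ is a real measurable function $p$ with $1\le p(t)<\infty$ (possibly unbounded). The variable Lebesgue space $L^{p(\cdot)}(\mu)$ is the space of all (classes of) real measurable $f$ on $\Omega$ such that $\rho_{p(\cdot)}(f/r)<\infty$ for some $r>0$, where $\rho_{p(\cdot)}(f)=\int_\Omega |f(t)|^{p(t)}d\mu$, with the Luxemburg norm $\|f\|_{p(\cdot)}=\inf\{r>0:\rho_{p(\cdot)}(f/r)\le 1\}$. On a finite measure space $L^{p(\cdot)}(\mu)\subset L^1(\mu)$ with continuous inclusion. For measurable $f$ on $\Omega$, the distribution function is $\mu_f(s)=\mu(\{t\in\Omega:|f(t)|>s\})$ and the decreasing rearrangement is $f^*(x)=\inf\{s\in[0,\infty):\mu_f(s)\le x\}$ for $x\in[0,\mu(\Omega))$. An operator $T:E\to F$ from a Banach lattice $E$ to a Banach space $F$ is disjointly strictly singular (DSS) if there is no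 normalized pairwise disjoint sequence $(f_n)$ in $E$ such that the restriction of $T$ to the closed linear span $[f_n]$ is an isomorphism onto its image. *)

(* Defs.v *)
From HB Require Import structures.
From mathcomp Require Import all_boot all_order all_algebra generic_quotient.
From mathcomp Require Import all_classical all_reals all_analysis.
From mathcomp Require Import measurable_realfun ring.

Set Implicit Arguments.
Unset Strict Implicit.
Unset Printing Implicit Defensive.
Import Order.TTheory GRing.Theory Num.Theory.
Import numFieldNormedType.Exports.

Local Open Scope classical_set_scope.
Local Open Scope ring_scope.
Local Open Scope quotient_scope.

Section ae_classes.
Context (d : measure_display) (T : measurableType d) (R : realType).
Variable mu : {measure set T -> \bar R}.
Local Notation M := {mfun T >-> R}.
Local Notation Q := {mfun_ mu, T >-> R}.
Implicit Types (f g : M) (x y z : Q) (a b : R).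

Lemma pi_aeE f g : \pi_Q f = \pi_Q g <-> (f = g %[ae mu]).
Proof. by split=> [/eqmodP/asboolP //|fg]; apply/eqmodP/asboolP. Qed.

Lemma repr_ae f : (repr (\pi_Q f) : M) = f %[ae mu].
Proof. by apply/pi_aeE; rewrite reprK. Qed.

Definition ae_add x y : Q := \pi_Q ((repr x : M) + (repr y : M)).
Definition ae_opp x : Q := \pi_Q (- (repr x : M)).
Definition ae_scale a x : Q := \pi_Q (a *: (repr x : M)).

Lemma ae_addE f g : ae_add (\pi_Q f) (\pi_Q g) = \pi_Q (f + g).
Proof.
apply/pi_aeE; have := repr_ae g; have := repr_ae f.
by apply: filterS2 => t ft gt _; rewrite !mfunD /= ft// gt.
Qed.

Lemma ae_oppE f : ae_opp (\pi_Q f) = \pi_Q (- f).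
Proof.
by apply/pi_aeE; have := repr_ae f; apply: filterS => t ft _; rewrite !mfunN /= ft.
Qed.

Lemma ae_scaleE a f : ae_scale a (\pi_Q f) = \pi_Q (a *: f).
Proof.
by apply/pi_aeE; have := repr_ae f; apply: filterS => t ft _;
  rewrite -[LHS]/(a * (repr (\pi_Q f) : M) t) ft.
Qed.

Lemma ae_addA : associative ae_add.
Proof.
elim/quotW=> f; elim/quotW=> g; elim/quotW=> h.
by rewrite (ae_addE g h) (ae_addE f g) (ae_addE f) (ae_addE _ h) addrA.
Qed.

Lemma ae_addC : commutative ae_add.
Proof. by elim/quotW=> f; elim/quotW=> g; rewrite (ae_addE f g) (ae_addE g f) addrC. Qed.

Lemma ae_add0 : left_id (\pi_Q (0 : M)) ae_add.
Proof. by elim/quotW=> f; rewrite (ae_addE 0 f) add0r. Qed.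

Lemma ae_addN : left_inverse (\pi_Q (0 : M)) ae_opp ae_add.
Proof. by elim/quotW=> f; rewrite (ae_oppE f) (ae_addE _ f) addNr. Qed.

HB.instance Definition _ :=
  GRing.isZmodule.Build Q ae_addA ae_addC ae_add0 ae_addN.

Lemma ae_scaleA a b x : ae_scale a (ae_scale b x) = ae_scale (a * b) x.
Proof. by elim/quotW: x => f; rewrite (ae_scaleE b f) (ae_scaleE _ f) (ae_scaleE a) scalerA. Qed.

Lemma ae_scale1 : left_id 1 ae_scale.
Proof. by elim/quotW=> f; rewrite ae_scaleE scale1r. Qed.

Lemma ae_scaleDr : right_distributive ae_scale +%R.
Proof.
move=> a; elim/quotW=> f; elim/quotW=> g.
by rewrite [_ + _](ae_addE f g) (ae_scaleE a (f + g)) (ae_scaleE a f) (ae_scaleE a g)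
  [RHS](ae_addE (a *: f) (a *: g)) scalerDr.
Qed.

Lemma ae_scaleDl x : {morph ae_scale^~ x : a b / a + b}.
Proof.
move=> a b; elim/quotW: x => f.
rewrite (ae_scaleE (a + b) f) (ae_scaleE a f) (ae_scaleE b f).
by rewrite [RHS](ae_addE (a *: f) (b *: f)) scalerDl.
Qed.

HB.instance Definition _ := GRing.Zmodule_isLmodule.Build R Q
  ae_scaleA ae_scale1 ae_scaleDr ae_scaleDl.

Lemma measurable_ae_class x : measurable_fun [set: T] x.
Proof. exact: measurable_funPT. Qed.

Lemma ae_class0 : ((0 : Q) : T -> R) = cst 0 %[ae mu].
Proof. exact: repr_ae. Qed.

Lemma ae_classD x y : ((x + y : Q) : T -> R) = (x : T -> R) \+ y %[ae mu].
Proof. exact: repr_ae. Qed.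

Lemma ae_classZ a x :
  ((a *: x : Q) : T -> R) = (fun t => a * x t) %[ae mu].
Proof. exact: repr_ae. Qed.

Lemma ae_class_eq0 x : (x : T -> R) = cst 0 %[ae mu] -> x = 0.
Proof.
move=> x0; transitivity (\pi_Q (repr x : M)); first by rewrite reprK.
exact/pi_aeE.
Qed.

End ae_classes.

Record exponent (d : measure_display) (T : measurableType d) (R : realType) :=
  Exponent { expo :> {mfun T >-> R}; expo_ge1 : forall t, 1 <= expo t }.

Section modular.
Context (d : measure_display) (T : measurableType d) (R : realType).
Variables (mu : {measure set T -> \bar R}) (p : exponent T R).
Implicit Types (f g : T -> R) (r s : R).

Definition modular f : \bar R := (\int[mu]_t (`|f t| `^ p t)%:E)%E.

Definition luxemburg f : R :=
  inf [set r | 0 < r /\ (modular (fun t => (f t / r)%R) <= 1)%E].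

Definition varLfun f : Prop :=
  measurable_fun setT f /\
  exists2 r, 0 < r & (modular (fun t => (f t / r)%R) < +oo)%E.

Local Notation mf := (measurable_fun [set: T]).

Lemma expo_gt0 t : 0 < p t.
Proof. exact: lt_le_trans (expo_ge1 p t). Qed.

Lemma measurable_modular f : mf f -> mf (fun t => (`|f t| `^ p t)%:E).
Proof.
move=> f_meas; apply/measurable_EFinP.
rewrite (_ : (fun t => _) =
    fun t => if f t == 0 then 0 else expR (p t * ln `|f t|)); last first.
  apply/funext => t; rewrite /powR normr_eq0.
  by case: ifP => // _; rewrite gt_eqF ?expo_gt0.
apply: measurable_fun_ifT.
- exact: measurable_fun_eqr.
- exact: measurable_cst.
- apply: measurableT_comp => //; apply: measurable_funM => //.
  by apply: measurableT_comp => //; exact: measurableT_comp.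
Qed.

Lemma modular_ge0 f : (0 <= modular f)%E.
Proof. by apply: integral_ge0 => t _; rewrite lee_fin powR_ge0. Qed.

Lemma le_modular f g : mf f -> mf g -> (forall t, `|f t| <= `|g t|) ->
  (modular f <= modular g)%E.
Proof.
move=> mf_ mg fg; apply: ge0_le_integral => //.
- exact: measurable_modular.
- exact: measurable_modular.
- move=> t _; rewrite lee_fin ge0_ler_powR ?nnegrE//.
  exact/ltW/expo_gt0.
Qed.

Lemma ae_modular f g : mf f -> mf g -> f = g %[ae mu] -> modular f = modular g.
Proof.
move=> f_meas g_meas fg; apply: ge0_ae_eq_integral => //.
- exact: measurable_modular.
- exact: measurable_modular.
- by apply: filterS fg => t fgt _; rewrite fgt.
Qed.

Lemma modular_convex f g a : mf f -> mf g -> 0 <= a <= 1 ->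
  (modular (fun t => (a * f t + (1 - a) * g t)%R) <=
    a%:E * modular f + (1 - a)%:E * modular g)%E.
Proof.
move=> f_meas g_meas /andP[a0 a1].
have a1' : 0 <= 1 - a by rewrite subr_ge0.
rewrite -ge0_integralZl_EFin//; last exact: measurable_modular.
rewrite -ge0_integralZl_EFin//; last exact: measurable_modular.
rewrite -ge0_integralD//; last first.
- by apply: emeasurable_funM => //; exact: measurable_modular.
- by move=> t _; rewrite -EFinM lee_fin mulr_ge0 ?powR_ge0.
- by apply: emeasurable_funM => //; exact: measurable_modular.
- by move=> t _; rewrite -EFinM lee_fin mulr_ge0 ?powR_ge0.
apply: ge0_le_integral => //.
- apply: measurable_modular.
  by apply: measurable_funD; apply: measurable_funM.
- by apply: emeasurable_funD;
    apply: emeasurable_funM => //; exact: measurable_modular.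
move=> t _; rewrite -!EFinM -EFinD lee_fin.
apply: (@le_trans _ _ ((a * `|f t| + (1 - a) * `|g t|) `^ p t)).
  rewrite ge0_ler_powR ?nnegrE ?(ltW (expo_gt0 t))//.
    by rewrite addr_ge0// mulr_ge0.
  by rewrite (le_trans (ler_normD _ _))// !normrM (ger0_norm a0) (ger0_norm a1').
have := @convex_powR R (p t) (expo_ge1 p t) (Itv01 a0 a1) `|f t| `|g t|.
by rewrite !inE/= !in_itv/= !normr_ge0 !convRE; apply.
Qed.

Lemma modular0 : modular (fun=> 0%R) = 0%E.
Proof.
rewrite /modular integral0_eq// => t _.
by rewrite normr0 powR0// gt_eqF// expo_gt0.
Qed.

Lemma modular_eq0 f : mf f -> modular f = 0%E -> f = cst 0 %[ae mu].
Proof.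
move=> f_meas m0.
have := ae_eq_integral_abs mu measurableT (measurable_modular f_meas).
case=> + _; rewrite (_ : integral _ _ _ = modular f); last first.
  by apply: eq_integral => t _; rewrite gee0_abs// lee_fin powR_ge0.
move=> /(_ m0); apply: filterS => t /(_ I) [] /eqP + _.
by rewrite powR_eq0 normr_eq0 => /andP[/eqP].
Qed.

Local Opaque modular.

Lemma modular_scale f a : mf f -> 0 <= a <= 1 ->
  (modular (fun t => (a * f t)%R) <= a%:E * modular f)%E.
Proof.
move=> f_meas a01; have m0 : mf (fun=> 0 : R) by exact: measurable_cst.
have := modular_convex f_meas m0 a01.
rewrite modular0 mule0 adde0.
have E : (fun t => a * f t + (1 - a) * 0) = (fun t => a * f t).
  by apply/funext => t; rewrite mulr0 addr0.
by rewrite E.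
Qed.

Lemma measurable_funZ f r : mf f -> mf (fun t => f t / r).
Proof. by move=> f_meas; apply: measurable_funM. Qed.
Hint Resolve measurable_funZ : core.

Lemma luxemburg_set_lbound f :
  has_lbound [set r | 0 < r /\ (modular (fun t => (f t / r)%R) <= 1)%E].
Proof. by exists 0 => r [/ltW]. Qed.
Hint Resolve luxemburg_set_lbound : core.

Lemma luxemburg_set_neq0 f : varLfun f ->
  [set r | 0 < r /\ (modular (fun t => (f t / r)%R) <= 1)%E] !=set0.
Proof.
move=> [f_meas [r r0 fr]].
have mge0 := modular_ge0 (fun t => (f t / r)%R).
set m := modular _ in fr mge0.
have mfin : m \is a fin_num by rewrite ge0_fin_numE.
have fm0 : 0 <= fine m by exact: fine_ge0.
have c1 : 0 < 1 + fine m by rewrite ltr_pwDl.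
exists (r * (1 + fine m)); split; first by rewrite mulr_gt0.
rewrite (_ : (fun t => _) = fun t => (1 + fine m)^-1 * (f t / r)); last first.
  by apply/funext => t; rewrite invfM mulrA mulrC.
apply: (le_trans (modular_scale _ _)) => //.
- exact: measurable_funZ.
- by rewrite invr_ge0 ltW//= invf_le1// lerDl.
rewrite -/m -(fineK mfin) -EFinM lee_fin mulrC ler_pdivrMr// mul1r lerDr//.
Qed.

Lemma luxemburg_ge0 f : 0 <= luxemburg f.
Proof.
rewrite /luxemburg; set S := (X in inf X).
have [->|/set0P S0] := eqVneq S set0; first by rewrite inf0.
by apply: lb_le_inf => // r [/ltW].
Qed.

Lemma ae_luxemburg f g : mf f -> mf g -> f = g %[ae mu] ->
  luxemburg f = luxemburg g.
Proof.
move=> f_meas g_meas fg.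
have E r : modular (fun t => f t / r) = modular (fun t => g t / r).
  apply: ae_modular; [exact: measurable_funZ..|].
  by apply: filterS fg => t fgt _; rewrite fgt.
by apply: (congr1 inf); apply/funext => r; rewrite /mkset E.
Qed.

Lemma ae_varLfun f g : mf f -> mf g -> f = g %[ae mu] ->
  varLfun f -> varLfun g.
Proof.
move=> f_meas g_meas fg [_ [r r0 fr]]; split; first exact: g_meas.
exists r; first exact: r0.
have <- : modular (fun t => f t / r) = modular (fun t => g t / r).
  apply: ae_modular; [exact: measurable_funZ..|].
  by apply: filterS fg => t fgt _; rewrite fgt.
exact: fr.
Qed.

Lemma varLfun0 : varLfun (fun=> 0).
Proof.
split; first exact: measurable_cst.
exists 1 => //; rewrite (_ : (fun=> _) = fun=> 0) ?modular0//.
by apply/funext => t; rewrite mul0r.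
Qed.

Lemma modularD f g r s : mf f -> mf g -> 0 < r -> 0 < s ->
  (modular (fun t => ((f t + g t) / (r + s))%R) <=
   (r / (r + s))%:E * modular (fun t => (f t / r)%R) +
   (1 - r / (r + s))%:E * modular (fun t => (g t / s)%R))%E.
Proof.
move=> f_meas g_meas r0 s0; have rs0 : 0 < r + s by rewrite addr_gt0.
have := @modular_convex (fun t => f t / r) (fun t => g t / s) (r / (r + s))
  (measurable_funZ r f_meas) (measurable_funZ s g_meas).
have -> : 0 <= r / (r + s) <= 1.
  by rewrite divr_ge0 ?(ltW r0) ?(ltW rs0)//= ler_pdivrMr// mul1r lerDl ltW.
move=> /(_ isT).
have E : (fun t => r / (r + s) * (f t / r) + (1 - r / (r + s)) * (g t / s)) =
    (fun t => (f t + g t) / (r + s)).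
  by apply/funext => t; field; rewrite !gt_eqF.
by rewrite E.
Qed.

Lemma varLfunD f g : varLfun f -> varLfun g -> varLfun (f \+ g).
Proof.
move=> [f_meas [r r0 fr]] [g_meas [s s0 gs]]; split.
  exact: measurable_funD.
exists (r + s); first exact: addr_gt0.
apply: le_lt_trans (modularD f_meas g_meas r0 s0) _.
have a0 : 0 <= r / (r + s) by rewrite divr_ge0 ?addr_ge0 ?ltW.
have a1 : 0 <= 1 - r / (r + s).
  by rewrite subr_ge0 ler_pdivrMr ?addr_gt0// mul1r lerDl ltW.
apply: lte_add_pinfty.
- by apply: lte_mul_pinfty; [rewrite lee_fin; exact: a0|by []|exact: fr].
- by apply: lte_mul_pinfty; [rewrite lee_fin; exact: a1|by []|exact: gs].
Qed.

Lemma luxemburgD f g : varLfun f -> varLfun g ->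
  luxemburg (f \+ g) <= luxemburg f + luxemburg g.
Proof.
move=> vf vg; rewrite -lerBlDr; apply: lb_le_inf.
  exact: luxemburg_set_neq0.
move=> r [r0 fr]; rewrite lerBlDl -lerBlDr; apply: lb_le_inf.
  exact: luxemburg_set_neq0.
move=> s [s0 gs]; rewrite lerBlDr; apply: (ge_inf (luxemburg_set_lbound _)).
rewrite addrC; split; first exact: addr_gt0.
apply: le_trans (modularD vf.1 vg.1 r0 s0) _.
have a0 : 0 <= r / (r + s) by rewrite divr_ge0 ?addr_ge0 ?ltW.
have a1 : 0 <= 1 - r / (r + s).
  by rewrite subr_ge0 ler_pdivrMr ?addr_gt0// mul1r lerDl ltW.
apply: (@le_trans _ _ ((r / (r + s))%:E * 1 + (1 - r / (r + s))%:E * 1)%E).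
  apply: leeD.
    by apply: lee_wpmul2l; [rewrite lee_fin; exact: a0|exact: fr].
  by apply: lee_wpmul2l; [rewrite lee_fin; exact: a1|exact: gs].
by rewrite !mule1 -EFinD lee_fin addrC subrK.
Qed.

Lemma varLfunZ f a : varLfun f -> varLfun (fun t => a * f t).
Proof.
move=> vf; have [-> |a0] := eqVneq a 0.
  rewrite (_ : (fun _ => _) = fun=> 0); first exact: varLfun0.
  by apply/funext => t; rewrite mul0r.
case: vf => f_meas [r r0 fr]; split; first exact: measurable_funM.
exists (`|a| * r); first by rewrite mulr_gt0 ?normr_gt0.
apply: le_lt_trans fr; apply: le_modular.
- by apply: measurable_funZ; apply: measurable_funM.
- exact: measurable_funZ.
- move=> t; rewrite !normrM !normfV normrM normr_id (gtr0_norm r0).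
  by rewrite invfM mulrACA divff ?normr_eq0// mul1r.
Qed.

Lemma luxemburgZ_le f a : varLfun f -> a != 0 ->
  luxemburg (fun t => a * f t) <= `|a| * luxemburg f.
Proof.
move=> vf a0; rewrite mulrC -ler_pdivrMr ?normr_gt0//.
apply: lb_le_inf; first exact: luxemburg_set_neq0.
move=> r [r0 fr]; rewrite ler_pdivrMr ?normr_gt0//; apply: (ge_inf (luxemburg_set_lbound _)).
split; first by rewrite mulr_gt0 ?normr_gt0.
apply: le_trans fr; have f_meas := vf.1; apply: le_modular.
- by apply: measurable_funZ; apply: measurable_funM.
- exact: measurable_funZ.
- move=> t; rewrite !normrM !normfV normrM normr_id (gtr0_norm r0).
  by rewrite [r * _]mulrC invfM mulrACA divff ?normr_eq0// mul1r.
Qed.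

Lemma luxemburg0 : luxemburg (fun=> 0) = 0.
Proof.
apply/le_anti; rewrite luxemburg_ge0 andbT; apply/ler_addgt0Pl => e e0.
rewrite addr0; apply: (ge_inf (luxemburg_set_lbound _)); split => //.
rewrite (_ : (fun=> _) = fun=> 0) ?modular0//.
by apply/funext => t; rewrite mul0r.
Qed.

Lemma luxemburgZ f a : varLfun f ->
  luxemburg (fun t => a * f t) = `|a| * luxemburg f.
Proof.
move=> vf; have [->|a0] := eqVneq a 0.
  rewrite normr0 mul0r -[RHS]luxemburg0; congr luxemburg.
  by apply/funext => t; rewrite mul0r.
apply/le_anti; rewrite luxemburgZ_le//=.
have a'0 : a^-1 != 0 by rewrite invr_eq0.
have := luxemburgZ_le (varLfunZ a vf) a'0.
have -> : (fun t => a^-1 * (a * f t)) = f.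
  by apply/funext => t; rewrite mulrA mulVf ?mul1r.
by rewrite normfV ler_pdivlMl ?normr_gt0.
Qed.

Lemma luxemburg_eq0 f : varLfun f -> luxemburg f = 0 -> f = cst 0 %[ae mu].
Proof.
move=> vf f0; have f_meas := vf.1.
have m0 : modular f = 0%E.
  apply/le_anti; rewrite modular_ge0 andbT; apply/lee_addgt0Pr => e e0.
  have : luxemburg f < Num.min e 1 by rewrite f0 lt_min e0 ltr01.
  move/(inf_lt (luxemburg_set_neq0 vf)) => [r [r0 fr]].
  rewrite lt_min => /andP[re r1]; rewrite add0e.
  rewrite (_ : modular f = modular (fun t => r * (f t / r))); last first.
    congr modular; apply/funext => t.
    by rewrite mulrC divfK ?gt_eqF.
  apply: le_trans (modular_scale _ _) _.
  - exact: measurable_funZ.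
  - by rewrite !ltW.
  apply: (@le_trans _ _ (r%:E * 1)%E).
    by apply: lee_wpmul2l; [rewrite lee_fin ltW|exact: fr].
  by rewrite mule1 lee_fin ltW.
exact: modular_eq0.
Qed.

Transparent modular.

End modular.

Section varL.
Context (d : measure_display) (T : measurableType d) (R : realType).
Variables (mu : {measure set T -> \bar R}) (p : exponent T R).
Local Notation Q := {mfun_ mu, T >-> R}.

Definition varL_pred : {pred Q} := [pred x : Q | `[< varLfun mu p x >]].

(* L^p(.)(mu): a.e.-classes whose chosen representative is in varLfun, or
   equivalently (ae_varLfun) all of whose representatives are. *)
Record varL := VarL { varL_class :> Q; _ : varL_class \in varL_pred }.

HB.instance Definition _ := [isSub for varL_class].
HB.instance Definition _ := [Choice of varL by <:].

Lemma varL_predP (x : Q) : reflect (varLfun mu p x) (x \in varL_pred).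
Proof. exact: asboolP. Qed.

Lemma varL_submod_closed : submod_closed varL_pred.
Proof.
split=> [|a x y].
  apply/varL_predP; apply: (@ae_varLfun _ _ _ mu p (fun=> 0)).
  - exact: measurable_cst.
  - exact: measurable_ae_class.
  - by apply: filterS (ae_class0 mu) => t + It => /(_ It) ->.
  - exact: varLfun0.
move: (x : Q) (y : Q) => {}x {}y.
move=> /varL_predP vx /varL_predP vy; apply/varL_predP.
apply: (@ae_varLfun _ _ _ mu p ((fun t => a * x t) \+ y)).
- apply: measurable_funD; last exact: measurable_ae_class.
  by apply: measurable_funM; [exact: measurable_cst|exact: measurable_ae_class].
- exact: measurable_ae_class.
- apply: filterS2 (ae_classD (a *: x) y) (ae_classZ a x) => t h1 h2 It.
  by rewrite (h1 It)/= (h2 It).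
- by apply: varLfunD; [exact: varLfunZ|exact: vy].
Qed.

HB.instance Definition _ := GRing.isSubmodClosed.Build R Q varL_pred
  varL_submod_closed.
HB.instance Definition _ := [SubChoice_isSubLmodule of varL by <:].

Definition varL_norm (x : varL) : R := luxemburg mu p x.

Lemma varLP (x : varL) : varLfun mu p x.
Proof. exact/varL_predP/valP. Qed.

Lemma varL_normD x y : varL_norm (x + y) <= varL_norm x + varL_norm y.
Proof.
have <- : luxemburg mu p ((x : T -> R) \+ y) = varL_norm (x + y).
  apply: ae_luxemburg.
  - by apply: measurable_funD; exact: measurable_ae_class.
  - exact: measurable_ae_class.
  - by apply: filterS (ae_classD x y) => t + It => /(_ It) ->.
exact: luxemburgD (varLP x) (varLP y).
Qed.

Lemma varL_normZ a x : varL_norm (a *: x) = `|a| * varL_norm x.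
Proof.
rewrite -(luxemburgZ a (varLP x)); apply: ae_luxemburg.
- exact: measurable_ae_class.
- by apply: measurable_funM; [exact: measurable_cst|exact: measurable_ae_class].
- exact: ae_classZ.
Qed.

Lemma varL_norm_eq0 x : varL_norm x = 0 -> x = 0.
Proof.
move=> /(luxemburg_eq0 (varLP x)) x0.
by apply: val_inj; apply: ae_class_eq0.
Qed.

HB.instance Definition _ := Lmodule_isNormed.Build R varL
  varL_normD varL_normZ varL_norm_eq0.

End varL.

Section L1.
Context (d : measure_display) (T : measurableType d) (R : realType).
Variable mu : {measure set T -> \bar R}.
Local Notation Q := {mfun_ mu, T >-> R}.

Definition L1_pred : {pred Q} := [pred x : Q | finite_norm mu 1 x].

(* hoelder.LspaceType carries no algebraic or normed structure. *)
Record L1 := InL1 { L1_class :> Q; _ : L1_class \in L1_pred }.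

HB.instance Definition _ := [isSub for L1_class].
HB.instance Definition _ := [Choice of L1 by <:].

Lemma L1_predE (x : Q) : (x \in L1_pred) = finite_norm mu 1 x.
Proof. by []. Qed.

Lemma ae_Lnorm1 (f g : T -> R) :
  measurable_fun setT f -> measurable_fun setT g -> f = g %[ae mu] ->
  'N[mu]_1[EFin \o f]%E = 'N[mu]_1[EFin \o g]%E.
Proof.
move=> mf mg fg; rewrite !Lnorm1; apply: ge0_ae_eq_integral => //.
- by apply: measurableT_comp => //; exact/measurable_EFinP.
- by apply: measurableT_comp => //; exact/measurable_EFinP.
- by apply: filterS fg => t /= + _ => ->.
Qed.

Lemma Lnorm1Z (f : T -> R) (a : R) : measurable_fun setT f ->
  'N[mu]_1[EFin \o (fun t => a * f t)%R]%E = (`|a|%:E * 'N[mu]_1[EFin \o f])%E.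
Proof.
move=> mf; rewrite !Lnorm1 -ge0_integralZl_EFin//.
- by apply: eq_integral => t _ /=; rewrite normrM EFinM.
- by apply: measurableT_comp => //; exact/measurable_EFinP.
Qed.

Lemma L1_submod_closed : submod_closed L1_pred.
Proof.
split=> [|a x y]; rewrite !L1_predE /finite_norm.
  rewrite (@ae_Lnorm1 _ (cst 0))// ?Lnorm0//.
  exact: ae_class0.
move: (x : Q) (y : Q) => {}x {}y.
move=> x1 y1; rewrite (@ae_Lnorm1 _ (fun t => a * x t + y t))//; last 2 first.
- by apply: measurable_funD => //; exact: measurable_funM.
- apply: filterS2 (ae_classD (a *: x) y) (ae_classZ a x) => t /= h1 h2 _.
  by rewrite h1// h2.
apply: (@le_lt_trans _ _ ('N[mu]_1[EFin \o (fun t => a * x t)%R] +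
    'N[mu]_1[EFin \o y])%E).
  by apply: eminkowski => //; exact: measurable_funM.
rewrite lte_add_pinfty// Lnorm1Z// lte_mul_pinfty//.
Qed.

HB.instance Definition _ := GRing.isSubmodClosed.Build R Q L1_pred
  L1_submod_closed.
HB.instance Definition _ := [SubChoice_isSubLmodule of L1 by <:].

Definition L1_norm (x : L1) : R := fine 'N[mu]_1[EFin \o x]%E.

Lemma L1_normE (x : L1) : (L1_norm x)%:E = 'N[mu]_1[EFin \o x]%E.
Proof.
have x1 : finite_norm mu 1 x by have := valP x.
by rewrite fineK// ge0_fin_numE// Lnorm_ge0.
Qed.

Lemma L1_normD x y : L1_norm (x + y) <= L1_norm x + L1_norm y.
Proof.
rewrite -lee_fin EFinD !L1_normE (@ae_Lnorm1 _ ((x : T -> R) \+ y)).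
- exact: eminkowski.
- exact: measurable_ae_class.
- by apply: measurable_funD; exact: measurable_ae_class.
- exact: ae_classD.
Qed.

Lemma L1_normZ a x : L1_norm (a *: x) = `|a| * L1_norm x.
Proof.
apply: EFin_inj; rewrite EFinM !L1_normE -Lnorm1Z; last exact: measurable_ae_class.
apply: ae_Lnorm1.
- exact: measurable_ae_class.
- by apply: measurable_funM; [exact: measurable_cst|exact: measurable_ae_class].
- exact: ae_classZ.
Qed.

Lemma L1_norm_eq0 x : L1_norm x = 0 -> x = 0.
Proof.
move=> x0; apply: val_inj; apply: ae_class_eq0.
have := L1_normE x; rewrite x0 => /esym /Lnorm_eq0_eq0.
have mx : measurable_fun setT (EFin \o x).
  by apply/measurable_EFinP; exact: measurable_ae_class.
move=> /(_ mx lte01).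
by apply: filterS => t /(_ I) [].
Qed.

HB.instance Definition _ := Lmodule_isNormed.Build R L1
  L1_normD L1_normZ L1_norm_eq0.

End L1.

Arguments L1_pred {d T R} mu.
Arguments varL_pred {d T R} mu p.

Section inclusion.
Context (d : measure_display) (T : measurableType d) (R : realType).
Variables (mu : {finite_measure set T -> \bar R}) (p : exponent T R).

Lemma varL_L1 (x : varL mu p) : (x : {mfun_ mu, T >-> R}) \in L1_pred mu.
Proof.
rewrite L1_predE /finite_norm Lnorm1.
have [x_meas [r r0 xr]] := varLP x.
have mxr := measurable_funZ r x_meas.
have mxp := measurable_modular p mxr.
apply: (@le_lt_trans _ _
    (\int[mu]_t (r%:E * (1 + (`|x t / r| `^ p t)%:E)))%E).
  apply: ge0_le_integral => //.
  - by apply: measurableT_comp => //; exact/measurable_EFinP.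
  - by apply: emeasurable_funM => //; apply: emeasurable_funD.
  move=> t _; rewrite /= -EFinD -EFinM lee_fin.
  rewrite mulrC -ler_pdivrMr// -[r in _ / r](gtr0_norm r0) -normf_div.
  set u := `|_|; have [u1|u1] := leP u 1.
    by rewrite (le_trans u1)// lerDl powR_ge0.
  by rewrite (@le_trans _ _ (u `^ p t)) ?lerDr// le1r_powR ?expo_ge1// ltW.
rewrite ge0_integralZl_EFin//; [|by move=> t _; rewrite adde_ge0// lee_fin powR_ge0
  |by apply: emeasurable_funD|exact: ltW].
rewrite ge0_integralD//.
apply: lte_mul_pinfty; [by rewrite lee_fin ltW|by []|].
apply: lte_add_pinfty; last exact: xr.
by rewrite integral_cst// mul1e ltey_eq fin_num_measure.
Qed.

(* Identity on classes; well defined because mu is finite. *)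
Definition inclusion (x : varL mu p) : L1 mu := InL1 (varL_L1 x).

Lemma inclusion_linear : linear inclusion.
Proof. by move=> a x y; apply: val_inj. Qed.

HB.instance Definition _ := GRing.isLinear.Build R (varL mu p) (L1 mu) _
  inclusion inclusion_linear.

End inclusion.

Arguments inclusion {d T R} mu p.

Section rearrangement.
Context (d : measure_display) (T : measurableType d) (R : realType).
Variable mu : {measure set T -> \bar R}.

Definition atomless : Prop := forall A : set T, measurable A ->
  (0 < mu A)%E -> exists B : set T,
    [/\ measurable B, B `<=` A & (0 < mu B < mu A)%E].

Definition distribution_function (f : T -> R) (s : R) : \bar R :=
  mu [set t | s < `|f t|].

(* Only meaningful for 0 <= x < mu setT; the value is +oo exactly when no
   level s qualifies, which can only happen at x = 0, for f unbounded. *)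
Definition decreasing_rearrangement (f : T -> R) (x : R) : \bar R :=
  ereal_inf [set s%:E | s in
    [set s : R | 0 <= s /\ (distribution_function f s <= x%:E)%E]].

End rearrangement.

(* a ^ y for a > 1 and y in [0, +oo]; the exponents of powR are finite. *)
Definition powRe (R : realType) (a : R) (y : \bar R) : \bar R :=
  expeR (y * (ln a)%:E).

Lemma powRe_EFin (R : realType) (a r : R) : 0 < a ->
  powRe a r%:E = (a `^ r)%:E.
Proof. by move=> a0; rewrite /powRe -EFinM /= /powR gt_eqF. Qed.

Section operators.
Context (R : realType).

Definition weak_space (E : normedModType R) : Type :=
  sup_topology (fun phi : {phi : {linear E -> R^o} | continuous phi} =>
    Topological.on (initial_topology (sval phi : E -> R^o))).

HB.instance Definition _ (E : normedModType R) :=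
  Topological.on (weak_space E).

Lemma weak_cvgP (E : normedModType R) (F : set_system E) (x : E) : Filter F ->
  F --> (x : weak_space E) <->
  forall phi : {linear E -> R^o}, continuous phi -> phi @ F --> phi x.
Proof.
move=> FF; split=> [/cvg_sup Fx phi cphi|Fx].
  have /= h := Fx (exist _ phi cphi).
  apply: (cvg_trans _ (@initial_continuous _ _ phi x)).
  move=> B; rewrite /= /nbhs/=; exact: h.
apply/cvg_sup => -[phi cphi] B.
rewrite (@nbhsE (initial_topology (phi : E -> R^o))) => -[_ [[C oC <-] /= Cx] CB].
have := Fx phi cphi C (open_nbhs_nbhs (conj oC Cx)).
exact: (@filterS _ F FF _ _ CB).
Qed.

Definition weakly_compact (E F : normedModType R) (A : {linear E -> F}) :=
  precompact (A @` [set x | `|x| <= 1] : set (weak_space F)).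

Definition linear_span (E : lmodType R) (f : nat -> E) : set E :=
  [set x | exists n (a : nat -> R), x = \sum_(i < n) a i *: f i].

Definition iso_onto_image (E F : normedModType R) (A : {linear E -> F})
    (S : set E) : Prop :=
  {within S, continuous A} /\
  exists2 g : F -> E, {in S, cancel A g} & {within A @` S, continuous g}.

(* [disj] is the disjointness relation |x| /\ |y| = 0 of the lattice E. *)
Definition disjointly_strictly_singular (E F : normedModType R)
    (disj : E -> E -> Prop) (A : {linear E -> F}) : Prop :=
  ~ exists f : nat -> E, [/\ forall n, `|f n| = 1,
      forall m n, m <> n -> disj (f m) (f n) &
      iso_onto_image A (closure (linear_span f))].

End operators.

Definition varL_disjoint (d : measure_display) (T : measurableType d)
    (R : realType) (mu : {measure set T -> \bar R}) (p : exponent T R)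
    (x y : varL mu p) : Prop :=
  {ae mu, forall t, Num.min `|x t| `|y t| = 0}.

Arguments varL_disjoint {d T R} mu p.

(* Main.v *)
Require Import Defs.
From HB Require Import structures.
From mathcomp Require Import all_boot all_order all_algebra generic_quotient.
From mathcomp Require Import all_classical all_reals all_analysis.
From mathcomp Require Import measurable_realfun lra ring.

(** Write [h = p / (p - 1)] for the conjugate exponent, [r = (p - 1) / p] for its
    inverse and [M] for the total mass. Each implication of the cycle
    (1) => (2) => (3) => (4) => (1) rests on one observation.

    From (1) to (2). Since [h] and its rearrangement have the same distribution,
    (1) says that [a ^ h] is integrable over the space for every [a > 1]. For
    [u >= 0] and [b > 1], wherever [p > 1] one has [u <= u ^ p / b + b ^ h], a
    weak form of Young's inequality ([conj_threshold]), so the unit ball of the variable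
    Lebesgue space is equi-integrable, and the Dunford-Pettis criterion
    ([dunford_pettis]) makes it relatively weakly compact in L^1. That criterion
    is proved with an ultrafilter: the limits of the integrals over measurable
    sets form an absolutely continuous set function, whose density is the weak
    limit.

    From (2) to (3). A disjoint normalized sequence on whose span the inclusion
    is an isomorphism has L^1 norms bounded below. A weak cluster point of the
    moduli would have integrals bounded below on the tails of the union of the
    supports, although these tails shrink to a null set.

    From (3) to (4). On the set where [r <= s] the exponent is at most
    [1 / (1 - s)], so an indicator supported there has norm at most
    [m ^ (1 - s)], where [m <= 1] is the measure of that set. If (4) fails,
    [m ^ s] stays away from 0 for suitable [s] tending to 0, so that this norm
    is at most a constant times [m]. Differences of such sublevel sets provide disjoint
    indicators with comparable norms in the two spaces. Because the L^1 norm is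
    additive on disjoint functions, both norms are equivalent to the sum of the
    moduli of the coefficients on the span of the normalized indicators, and
    the inclusion is an isomorphism on its closure.

    From (4) to (1). If [m] is the measure of the set where [h > s], then (4) at
    the point [M - m] bounds [m ^ (1 / s)] by any prescribed positive constant
    as soon as [s] is large, so the distribution of [h] decays faster than every
    exponential, and the layers [n < a ^ h] have summable measures. *)

Set Implicit Arguments.
Unset Strict Implicit.
Unset Printing Implicit Defensive.
Import Order.TTheory GRing.Theory Num.Theory.
Import numFieldNormedType.Exports.
Import HBSimple.

Local Open Scope classical_set_scope.
Local Open Scope ring_scope.

(** * Densities of finitely additive set functions *)

Section charge_of_set_function.
Context (d : measure_display) (T : measurableType d) (R : realType).
Variables (mu : {finite_measure set T -> \bar R}) (nu : set T -> R).
Hypothesis nuU : forall A B, measurable A -> measurable B -> A `&` B = set0 ->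
  nu (A `|` B) = nu A + nu B.
Hypothesis nu_ac : forall e : R, 0 < e -> exists2 dl : R, 0 < dl &
  forall A, measurable A -> (mu A < dl%:E)%E -> `|nu A| <= e.

Let nu0 : nu set0 = 0.
Proof.
have := nuU (@measurable0 _ T) (@measurable0 _ T) (setI0 _).
by rewrite setU0 => /eqP; rewrite -subr_eq subrr eq_sym => /eqP.
Qed.

Let enu (A : set T) : \bar R := (nu A)%:E.

Let enu0 : enu set0 = 0%E. Proof. by rewrite /enu nu0. Qed.

Let enu_fin A : measurable A -> enu A \is a fin_num. Proof. by []. Qed.

Let nu_bigsetU (F : nat -> set T) n : (forall i, measurable (F i)) ->
  trivIset setT F -> nu (\big[setU/set0]_(i < n) F i) = \sum_(i < n) nu (F i).
Proof.
move=> mF tF; elim: n => [|n IH]; first by rewrite !big_ord0.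
rewrite !big_ord_recr /= nuU ?IH//; first exact: bigsetU_measurable.
rewrite -bigcup_mkord -subset0 => t [[i /= im Fit] Fnt].
have /(_ (ex_intro _ t (conj Fit Fnt))) ei := tF i n I I.
by rewrite ei ltnn in im.
Qed.

(* A tail of a disjoint union decreases to the empty set, so its mu-measure
   tends to 0 and absolute continuity sends its value under [nu] to 0. *)
Let enu_sigma : semi_sigma_additive enu.
Proof.
move=> F mF tF mU; set U := \bigcup_n F n in mU *.
pose G n := U `\` \big[setU/set0]_(i < n) F i.
have mB n : measurable (\big[setU/set0]_(i < n) F i).
  exact: bigsetU_measurable.
have BU n : \big[setU/set0]_(i < n) F i `<=` U.
  by rewrite -bigcup_mkord; apply: bigcup_sub => i _; exact: bigcup_sup.
have mG n : measurable (G n) by exact: measurableD.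
have E n : nu U - nu (G n) = \sum_(0 <= i < n) nu (F i).
  rewrite big_mkord -nu_bigsetU//.
  have := @nuU (\big[setU/set0]_(i < n) F i) (G n) (mB n) (mG n).
  by rewrite setDIK setDUK; [move=> ->//; rewrite addrK|exact: BU].
have G0 : \bigcap_n G n = set0.
  rewrite -subset0 => t Gt; have [[n _ Fnt] _] := Gt 0%N I.
  have [_] := Gt n.+1 I; apply.
  by rewrite -bigcup_mkord; exists n => /=.
have muG : mu \o G @ \oo --> 0%E.
  rewrite -(measure0 mu) -G0; apply: nonincreasing_cvg_mu => //.
  - by rewrite ltey_eq fin_num_measure.
  - by rewrite G0.
  - move=> m n mn; apply/subsetPset => t [Ut nt]; split => // -.
    rewrite -bigcup_mkord => -[i /= im Fi]; apply: nt.
    by rewrite -bigcup_mkord; exists i => //=; exact: leq_trans mn.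
have nuG : nu \o G @ \oo --> 0.
  apply/cvgrPdist_le => e e0; have [dl dl0 ac] := nu_ac e0.
  have := muG; move=> /fine_cvgP[_] /cvgrPdist_lt /(_ _ dl0).
  apply: filterS => n; rewrite !sub0r !normrN /= => h.
  apply: ac => //; rewrite -(fineK (fin_num_measure mu _ (mG n))) lte_fin.
  exact: le_lt_trans (ler_norm _) h.
rewrite (_ : (fun n => _) = fun n => (nu U - nu (G n))%:E); last first.
  by apply/funext => n; rewrite E sumEFin.
apply: cvg_EFin; first exact: nearW.
rewrite -[X in _ --> X]subr0.
apply: cvgB; first exact: cvg_cst.
exact: nuG.
Qed.

HB.instance Definition _ :=
  isCharge.Build _ _ _ enu enu0 enu_fin enu_sigma.

(** Absolute continuity in the epsilon-delta form upgrades finite additivity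
    to countable additivity, so the Radon-Nikodym theorem applies to a set
    function that is only known to be finitely additive. This is the form in
    which set functions arise below, as limits along an ultrafilter and from
    functionals on L^1. *)
Lemma radon_nikodym_set_function : exists h : {mfun T >-> R},
  mu.-integrable setT (EFin \o h) /\
  forall A, measurable A -> nu A = \int[mu]_(x in A) h x.
Proof.
have dom : enu `<< mu.
  apply/null_content_dominatesP => A mA A0; congr EFin.
  apply/normr0_eq0/le_anti; rewrite normr_ge0 andbT.
  apply/ler_addgt0Pl => e e0; rewrite addr0; have [dl dl0 ac] := nu_ac e0.
  by apply: ac => //; rewrite A0 lte_fin.
have fin x := Radon_Nikodym_fin_num x dom.
have int := Radon_Nikodym_integrable dom.
have E : EFin \o (fine \o (Radon_Nikodym enu mu)) = (Radon_Nikodym enu mu).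
  by apply/funext => x /=; rewrite fineK.
have mh : measurable_fun setT (fine \o (Radon_Nikodym enu mu)).
  by apply/measurable_EFinP; rewrite E; exact: (measurable_int mu).
exists (mfun_Sub (mem_set mh)); split; first by rewrite /= E.
move=> A mA; apply: EFin_inj; rewrite -/(enu A) (Radon_Nikodym_integral dom mA).
rewrite -[LHS]fineK.
  by congr (_%:E); congr fine; apply: eq_integral => x _ /=; rewrite fineK.
by apply: integrable_fin_num => //; exact: integrableS int.
Qed.

End charge_of_set_function.

(** * Functionals and uniform approximation by step functions *)

Section linear_functionals.
Context (R : realType).

Lemma bounded_linear_functional (E : normedModType R) (phi : E -> R) (C : R) :
    (forall a x y, phi (a *: x + y) = a * phi x + phi y) ->
    (forall x, `|phi x| <= C * `|x|) ->
  exists2 Phi : {linear E -> R^o}, continuous Phi & forall x, Phi x = phi x.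
Proof.
move=> phiL phiC.
have lphi : linear (phi : E -> R^o) by move=> a x y; exact: phiL.
pose Phi : {linear E -> R^o} :=
  HB.pack (phi : E -> R^o) (GRing.isLinear.Build _ _ _ _ (phi : E -> R^o) lphi).
exists Phi => //; apply/linear_bounded_continuous/linear_boundedP.
exists C; split; first exact: num_real.
move=> r Cr x; apply: le_trans (phiC x) _.
by rewrite ler_wpM2r// ltW.
Qed.

Lemma continuous_functional_bound (E : normedModType R)
    (phi : {linear E -> R^o}) : continuous phi ->
  exists2 C : R, 0 <= C & forall x, `|phi x| <= C * `|x|.
Proof.
move=> /linear_bounded_continuous/linear_boundedP[r [_ h]].
exists (`|r| + 1); first by rewrite addr_ge0.
by move=> x; apply: h; rewrite ltr_pwDr// ler_norm.
Qed.

End linear_functionals.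

Section step_approximation.
Context (R : realType).

Lemma staircase (e u : R) (N : nat) : 0 < e -> 0 <= u <= N%:R * e ->
  `|u - e * \sum_(j < N) ((j.+1%:R * e <= u)%R : nat)%:R| <= e.
Proof.
move=> e0 /andP[u0 uN].
suff [h1 h2 _] : [/\ e * \sum_(j < N) ((j.+1%:R * e <= u)%R : nat)%:R <= u,
    (u < N.+1%:R * e -> u <= e * \sum_(j < N) ((j.+1%:R * e <= u)%R : nat)%:R + e) &
    (N%:R * e <= u -> e * \sum_(j < N) ((j.+1%:R * e <= u)%R : nat)%:R = N%:R * e)].
  rewrite ger0_norm ?subr_ge0// lerBlDl h2//.
  by apply: le_lt_trans uN _; rewrite ltr_pM2r// ltr_nat.
elim: {uN}N => [|N [h1 h2 h3]].
  rewrite big_ord0 mulr0 mul0r add0r mul1r; split => // /ltW; exact.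
rewrite big_ord_recr/= mulrDr; have [uN|uN] := leP (N.+1%:R * e) u.
- rewrite mulr1 h3; last first.
    by apply: le_trans uN; rewrite ler_pM2r// ler_nat.
  have E : N%:R * e + e = N.+1%:R * e by rewrite -natr1 mulrDl mul1r.
  by rewrite E; split=> // /ltW; rewrite -(natr1 N.+1) mulrDl mul1r.
- rewrite mulr0 addr0; split => //; first by move=> _; exact: h2.
Qed.

Context (d : measure_display) (T : measurableType d).

(** Every bounded measurable function is a uniform limit of linear
    combinations of indicators: a property that holds for indicators and
    passes to linear combinations and to uniform limits holds for all of
    them. Used twice, for the values of a functional on L^1 and for the
    densities that represent it. *)
Lemma bounded_measurable_ind (P : (T -> R) -> Prop) :
  (forall A, measurable A -> P (\1_A)) ->
  (forall (a : R) (f g : T -> R) (C : R),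
     measurable_fun setT f -> measurable_fun setT g ->
     (forall t, `|f t| <= C) -> (forall t, `|g t| <= C) ->
     P f -> P g -> P (fun t => a * f t + g t)) ->
  (forall (f : T -> R) (C : R),
     measurable_fun setT f -> (forall t, `|f t| <= C) ->
     (forall e : R, 0 < e -> exists2 g : T -> R, P g & [/\ measurable_fun setT g,
        forall t, `|g t| <= C + e & forall t, `|f t - g t| <= e]) -> P f) ->
  forall (f : T -> R) (C : R),
    measurable_fun setT f -> (forall t, `|f t| <= C) -> P f.
Proof.
move=> Pind Plin Plim f C mf fC; apply: (Plim _ C) => // e e0.
have C0 : 0 <= C := le_trans (normr_ge0 _) (fC point).
have [N CN] : exists N : nat, 2 * C <= N%:R * e.
  exists (Num.trunc (2 * C / e)).+1; rewrite -ler_pdivrMr//.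
  by apply/ltW/truncnS_gt.
(* The function is shifted by [C] to make it nonnegative, and approximated by
   the staircase on the superlevel sets of the shifted function. *)
pose A (j : nat) := [set t | j.+1%:R * e <= f t + C].
have mA j : measurable (A j).
  rewrite /A -[X in measurable X]setTI; apply: measurable_fun_le => //.
  exact: measurable_funD.
pose s n := fun t => e * \sum_(j < n) \1_(A j) t - C.
have P1 : P (cst 1).
  by rewrite (_ : cst 1 = \1_setT); [exact: Pind|rewrite indicT].
have mS n : measurable_fun setT (fun t => \sum_(j < n) \1_(A j) t : R).
  by apply: measurable_sum => j; exact: measurable_indic.
have bS n t : `|\sum_(j < n) \1_(A j) t : R| <= n%:R.
  apply: le_trans (ler_norm_sum _ _ _) _.
  apply: (@le_trans _ _ (\sum_(j < n) 1)).
    by apply: ler_sum => j _; rewrite indicE ger0_norm// lern1 leq_b1.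
  by rewrite big_const_ord iter_addr_0.
have PS n : P (fun t => \sum_(j < n) \1_(A j) t).
  elim: n => [|n IH].
    rewrite (_ : (fun _ => _) = \1_set0); first exact: Pind.
    by apply/funext => t; rewrite big_ord0 indicE in_set0.
  rewrite (_ : (fun _ => _) =
      fun t => 1 * (\sum_(j < n) \1_(A j) t) + \1_(A n) t); last first.
    by apply/funext => t; rewrite big_ord_recr/= mul1r.
  apply: (Plin _ _ _ n.+1%:R) => //.
  - by move=> t; rewrite (le_trans (bS n t))// ler_nat.
  - by move=> t; rewrite indicE ger0_norm// ler_nat; case: (_ \in _).
  - exact: Pind.
have sf t : `|f t - s N t| <= e.
  rewrite /s opprB addrA (_ : \sum_(j < N) \1_(A j) t =
      \sum_(j < N) ((j.+1%:R * e <= f t + C)%R : nat)%:R); last first.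
    apply: eq_bigr => j _; rewrite indicE; congr (_%:R); congr nat_of_bool.
    by apply/idP/idP; [rewrite inE|move=> ?; rewrite inE].
  have := fC t; rewrite ler_norml => /andP[l1 l2].
  rewrite addrAC -addrAC; apply: staircase => //; apply/andP; split.
    by rewrite -lerBlDr sub0r.
  by apply: le_trans CN; rewrite mulr_natl mulr2n lerD2r.
have Ps : P (s N).
  rewrite (_ : s N = fun t => e * (\sum_(j < N) \1_(A j) t) +
      ((- C) * cst 1 t + \1_set0 t)); last first.
    by apply/funext => t; rewrite /s indicE in_set0 addr0 mulr1.
  have mC : measurable_fun [set: T] (fun t => - C * cst 1 t + \1_set0 t).
    by apply: measurable_funD; [exact: measurable_funM|exact: measurable_indic].
  apply: (Plin _ _ _ (N%:R + C)) => //.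
  - by move=> t; rewrite (le_trans (bS _ _))// lerDl.
  - move=> t; rewrite indicE in_set0 addr0 mulr1 normrN ger0_norm//.
    by rewrite lerDr.
  - apply: (Plin _ _ _ 1) => //; last exact: Pind.
    + by move=> t; rewrite /cst normr1.
    + by move=> t; rewrite indicE in_set0 normr0.
exists (s N) => //; split => //.
- by apply: measurable_funB => //; apply: measurable_funM.
- move=> t; rewrite -[s N t](subKr (f t)).
  by apply: le_trans (ler_normB _ _) _; rewrite lerD.
Qed.

End step_approximation.

(** * The space L^1 and its dual *)

Section L1_tools.
Context (d : measure_display) (T : measurableType d) (R : realType).
Variable mu : {measure set T -> \bar R}.
Local Notation mf := (measurable_fun [set: T]).

Lemma L1_measurable (x : L1 mu) : mf x.
Proof. exact: measurable_ae_class. Qed.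

Lemma L1_integrable (x : L1 mu) : mu.-integrable setT (EFin \o x).
Proof.
apply/integrableP; split; first exact/measurable_EFinP/L1_measurable.
by have := valP x; rewrite L1_predE /finite_norm Lnorm1.
Qed.

Lemma L1_normRE (x : L1 mu) : `|x| = \int[mu]_t `|x t|.
Proof.
rewrite -[`|x|]/(L1_norm x) /L1_norm Lnorm1 /Rintegral.
by congr fine; apply: eq_integral.
Qed.

Lemma L1_class_ex (f : T -> R) : mf f -> mu.-integrable setT (EFin \o f) ->
  exists x : L1 mu, (x : T -> R) = f %[ae mu].
Proof.
move=> f_meas /integrableP[_ intf].
pose f' : {mfun T >-> R} := mfun_Sub (mem_set f_meas).
pose q : {mfun_ mu, T >-> R} := \pi_{mfun_ mu, T >-> R}%qT f'.
have qf : (q : T -> R) = f %[ae mu] by exact: repr_ae.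
have q1 : q \in L1_pred mu.
  rewrite L1_predE /finite_norm (ae_Lnorm1 (measurable_ae_class q) f_meas qf).
  by rewrite Lnorm1.
by exists (InL1 q1).
Qed.

Lemma L1_ae_inj (x y : L1 mu) : (x : T -> R) = y %[ae mu] -> x = y.
Proof.
move=> xy; apply/eqP; rewrite -subr_eq0; apply/eqP/val_inj/ae_class_eq0.
have h := @ae_classD _ _ _ mu (x : {mfun_ mu, T >-> R}) (- (y : {mfun_ mu, T >-> R})).
have h2 := @ae_classZ _ _ _ mu (-1) (y : {mfun_ mu, T >-> R}).
rewrite scaleN1r in h2.
apply: filterS3 xy h h2 => t e1 e2 e3 _.
by rewrite (e2 I) /= (e3 I) (e1 I) mulN1r subrr.
Qed.

Lemma L1_aeD (x y : L1 mu) : ((x + y : L1 mu) : T -> R) = x \+ y %[ae mu].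
Proof. exact: ae_classD. Qed.

Lemma L1_aeZ a (x : L1 mu) :
  ((a *: x : L1 mu) : T -> R) = (fun t => a * x t) %[ae mu].
Proof. exact: ae_classZ. Qed.

Lemma L1_ae_lin a (x y : L1 mu) :
  ((a *: x + y : L1 mu) : T -> R) = (fun t => a * x t + y t) %[ae mu].
Proof.
apply: filterS2 (L1_aeD (a *: x) y) (L1_aeZ a x) => t h1 h2 _.
by rewrite h1//= h2.
Qed.

Lemma ae_Rintegral (f g : T -> R) : mf f -> mf g -> f = g %[ae mu] ->
  \int[mu]_t f t = \int[mu]_t g t.
Proof.
move=> f_meas g_meas fg; congr fine; apply: ae_eq_integral => //.
- exact/measurable_EFinP.
- exact/measurable_EFinP.
- by apply: filterS fg => t h _; rewrite h.
Qed.

Lemma integrable_mul_bounded (f g : T -> R) (C : R) :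
  mu.-integrable setT (EFin \o f) -> mf g -> (forall t, `|g t| <= C) ->
  mu.-integrable setT (EFin \o (fun t => f t * g t)).
Proof.
move=> intf g_meas gC.
apply: (@integrableMl _ _ _ mu setT measurableT (EFin \o f) g) => //.
exists C; split; first exact: num_real.
by move=> x Cx t _ /=; apply: le_trans (gC t) (ltW Cx).
Qed.

Lemma mul_bounded_norm (f g : T -> R) (C : R) :
  mu.-integrable setT (EFin \o f) -> mf g -> (forall t, `|g t| <= C) ->
  `|\int[mu]_t (f t * g t)| <= C * \int[mu]_t `|f t|.
Proof.
move=> intf g_meas gC.
have intfg := integrable_mul_bounded intf g_meas gC.
apply: le_trans (le_normr_Rintegral measurableT intfg) _.
have intn : mu.-integrable setT (EFin \o (fun t => `|f t|)).
  exact: integrable_norm.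
rewrite -RintegralZl//; apply: le_Rintegral => //.
- exact: (integrable_norm intfg).
- exact: (integrableZl measurableT C intn).
- by move=> t _; rewrite normrM mulrC ler_wpM2r.
Qed.

Lemma bounded_pairing_functional (g : T -> R) (C : R) :
  mf g -> (forall t, `|g t| <= C) ->
  exists2 phi : {linear L1 mu -> R^o}, continuous phi &
    forall x, phi x = \int[mu]_t (x t * g t).
Proof.
move=> g_meas gC.
apply: (@bounded_linear_functional R (L1 mu) (fun x : L1 mu => \int[mu]_t (x t * g t)) C).
- move=> a x y.
  have ix := integrable_mul_bounded (L1_integrable x) g_meas gC.
  have iy := integrable_mul_bounded (L1_integrable y) g_meas gC.
  rewrite -RintegralZl// -RintegralD//; last exact: integrableZl ix.
  apply: ae_Rintegral.
  + by apply: measurable_funM => //; exact: L1_measurable.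
  + by do 2?apply: measurable_funD => //; do 2?apply: measurable_funM => //;
      exact: L1_measurable.
  + by apply: filterS (L1_ae_lin a x y) => t /(_ I) -> _; rewrite mulrDl mulrA.
- by move=> x; rewrite L1_normRE; apply: mul_bounded_norm => //; exact: L1_integrable.
Qed.

Lemma Rintegral_indicr (A : set T) (f : T -> R) : measurable A ->
  \int[mu]_(t in A) f t = \int[mu]_t (f t * \1_A t).
Proof.
move=> mA; rewrite Rintegral_mkcond; apply: eq_Rintegral => t _.
by rewrite patchE indicE; case: ifP => _; rewrite ?mulr1 ?mulr0.
Qed.

Lemma set_integral_functional (A : set T) : measurable A ->
  exists2 phi : {linear L1 mu -> R^o}, continuous phi &
    forall x, phi x = \int[mu]_(t in A) x t.
Proof.
move=> mA; have mi : mf (\1_A : T -> R) by exact: measurable_indic.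
have iC t : `|\1_A t : R| <= 1 by rewrite indicE ger0_norm// lern1 leq_b1.
have [phi cphi phiE] := bounded_pairing_functional mi iC.
exists phi; first exact: cphi.
by move=> x; rewrite phiE (Rintegral_indicr _ mA).
Qed.

End L1_tools.

Section L1_dual.
Context (d : measure_display) (T : measurableType d) (R : realType).
Variable mu : {finite_measure set T -> \bar R}.
Local Notation mf := (measurable_fun [set: T]).

Lemma bounded_integrable (f : T -> R) (C : R) : mf f ->
  (forall t, `|f t| <= C) -> mu.-integrable setT (EFin \o f).
Proof.
move=> f_meas fC; apply: measurable_bounded_integrable => //.
  by rewrite ltey_eq fin_num_measure.
exists C; split; first exact: num_real.
by move=> x Cx t _ /=; apply: le_trans (fC t) (ltW Cx).
Qed.

(** The test set is the superlevel set [C < h], on which [h - C] is positive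
    with a nonpositive integral. *)
Lemma integrable_le_ae (h : T -> R) (C : R) : mf h ->
  mu.-integrable setT (EFin \o h) ->
  (forall A, measurable A -> \int[mu]_(t in A) h t <= C * fine (mu A)) ->
  {ae mu, forall t, h t <= C}.
Proof.
move=> h_meas inth hC; pose A := [set t | C < h t].
have mA : measurable A.
  rewrite (_ : A = h @^-1` `]C, +oo[).
    by rewrite -[X in measurable X]setTI; exact: h_meas.
  by apply/seteqP; split => t /=; rewrite /A/= in_itv/= andbT.
have iA : mu.-integrable A (EFin \o h) by exact: integrableS inth.
have iC : mu.-integrable A (EFin \o cst C).
  apply: (@integrableS _ _ _ mu setT) => //.
  exact: (@bounded_integrable (cst C) `|C|).
have ge0 t : A t -> (0 <= (h t - C)%:E)%E.
  by move=> At; rewrite lee_fin subr_ge0 ltW.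
have I0 : (\int[mu]_(t in A) (h t - C)%:E = 0)%E.
  apply/le_anti; rewrite integral_ge0// andbT.
  rewrite -[X in (X <= _)%E]fineK; last first.
    by apply: integrable_fin_num => //; exact: (integrableB mA iA iC).
  rewrite lee_fin -/(Rintegral _ _ _) RintegralB// Rintegral_cst//.
  by rewrite subr_le0 hC.
have mhC : measurable_fun A (fun t => (h t - C)%:E).
  by apply/measurable_EFinP/measurable_funTS/measurable_funB.
have [+ _] := ae_eq_integral_abs mu mA mhC.
rewrite (_ : integral _ _ _ = 0%E); last first.
  by rewrite -[RHS]I0; apply: eq_integral => t tA; rewrite gee0_abs// ge0// -in_setE.
move=> /(_ erefl); apply: filterS => t h0; rewrite leNgt; apply/negP => At.
by have := h0 At => -[] /eqP; rewrite subr_eq0 gt_eqF.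
Qed.

(** The density of [A |-> phi (\1_A)] is bounded because [phi] is, and it
    represents [phi] on indicators, hence on bounded functions, hence on all
    of L^1 because bounded functions are dense. *)
Lemma L1_functional_repr (phi : {linear L1 mu -> R^o}) : continuous phi ->
  exists (g : {mfun T >-> R}) (C : R), (forall t, `|g t| <= C) /\
    forall x, phi x = \int[mu]_t (x t * g t).
Proof.
move=> cphi; have [C C0 phiC] := continuous_functional_bound cphi.
(* [choice] asks for a class for every set, measurable or not. *)
have ind_ex (A : set T) : exists x : L1 mu, measurable A ->
    (x : T -> R) = \1_A %[ae mu].
  have [mA|nA] := pselect (measurable A); last by exists 0.
  have [||x xE] := @L1_class_ex _ _ _ mu (\1_A).
  - exact: measurable_indic.
  - apply: (@bounded_integrable _ 1); first exact: measurable_indic.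
    by move=> t; rewrite indicE ger0_norm// lern1 leq_b1.
  - by exists x.
have [ind indE] := choice ind_ex.
pose nu A := phi (ind A).
have nuC A : measurable A -> `|nu A| <= C * fine (mu A).
  move=> mA; apply: le_trans (phiC _) _; rewrite ler_wpM2l// L1_normRE.
  have mi : mf (\1_A : T -> R) by exact: measurable_indic.
  rewrite (@ae_Rintegral _ _ _ mu _ (\1_A)).
  - by rewrite /Rintegral integral_indic// setIT.
  - by apply: measurableT_comp => //; exact: L1_measurable.
  - exact: measurable_indic.
  - apply: filterS (indE _ mA) => t /(_ I) -> _.
    by rewrite ger0_norm// indicE.
have [nuU nu_ac] : (forall A B, measurable A -> measurable B ->
    A `&` B = set0 -> nu (A `|` B) = nu A + nu B) /\
   (forall e : R, 0 < e -> exists2 dl : R, 0 < dl &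
    forall A, measurable A -> (mu A < dl%:E)%E -> `|nu A| <= e).
  split.
    move=> A B mA mB AB; rewrite /nu -linearD; congr (phi _).
    apply: L1_ae_inj.
    apply: filterS3 (indE _ (measurableU _ _ mA mB)) (L1_aeD (ind A) (ind B))
      (filterI (indE _ mA) (indE _ mB)) => t e1 e2 [e3 e4] _.
    rewrite e1// e2//= e3// e4// !indicE in_setU.
    have [tA|tA] := boolP (t \in A); have [tB|tB] := boolP (t \in B);
      rewrite ?addr0 ?add0r//.
    by exfalso; rewrite -falseE -(in_set0 t) -AB in_setI tA tB.
  move=> e e0; exists (e / (C + 1)); first by rewrite divr_gt0// ltr_pwDr.
  move=> A mA; rewrite -(fineK (fin_num_measure mu _ mA)) lte_fin => lt.
  apply: le_trans (nuC _ mA) _.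
  apply: (@le_trans _ _ ((C + 1) * fine (mu A))).
    by rewrite ler_wpM2r ?fine_ge0// lerDl.
  by rewrite mulrC -ler_pdivlMr ?ltW// ltr_pwDr.
have [h [inth nuE]] := radon_nikodym_set_function nuU nu_ac.
have h_meas : mf h by exact: measurable_funPT.
have hC1 : {ae mu, forall t, h t <= C}.
  apply: integrable_le_ae => // A mA; rewrite -nuE//.
  exact: le_trans (ler_norm _) (nuC _ mA).
have hC2 : {ae mu, forall t, - h t <= C}.
  apply: integrable_le_ae => //.
  - exact: measurableT_comp.
  - exact: integrableN inth.
  move=> A mA; apply: le_trans (nuC _ mA).
  under eq_Rintegral do rewrite -mulN1r.
  rewrite RintegralZl//; last exact: integrableS inth.
  by rewrite -nuE// mulN1r -normrN ler_norm.
(* The density is bounded by [C] only almost everywhere; truncating it gives a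
   bound at every point. *)
pose g0 t := Num.min (Num.max (h t) (- C)) C.
have mg0 : mf g0 by apply: measurable_minr => //; exact: measurable_maxr.
have gC t : `|g0 t| <= C.
  rewrite ler_norml /g0 ge_min lexx orbT andbT le_min le_max lexx orbT/=.
  by rewrite ge0_cp.
have gh : g0 = h %[ae mu].
  apply: filterS2 hC1 hC2 => t h1 h2 _; rewrite /g0.
  by rewrite max_l ?min_l// lerNl.
exists (mfun_Sub (mem_set mg0)), C; split => // x.
pose P (f : T -> R) := forall x : L1 mu, (x : T -> R) = f %[ae mu] ->
  phi x = \int[mu]_t (f t * g0 t).
(* Both sides are C-Lipschitz in the L^1 norm, so the set where they agree is
   closed in L^1. *)
have Pclosed (f : T -> R) : mf f -> mu.-integrable setT (EFin \o f) ->
    (forall e : R, 0 < e -> exists k, [/\ mf k,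
      mu.-integrable setT (EFin \o k), P k &
      \int[mu]_t `|f t - k t| <= e]) -> P f.
  move=> f_meas intf H y yE.
  apply/eqP; rewrite -subr_eq0 -normr_eq0; apply/eqP/le_anti.
  rewrite normr_ge0 andbT; apply/ler_addgt0Pl => e e0; rewrite addr0.
  have C2 : 0 < 2 * C + 1 by rewrite ltr_pwDr// mulr_ge0.
  have e'0 : 0 < e / (2 * C + 1) by rewrite divr_gt0.
  have [k [k_meas intk Pk fk]] := H _ e'0.
  have ifg := integrable_mul_bounded intf mg0 gC.
  have ikg := integrable_mul_bounded intk mg0 gC.
  have [w wE] := L1_class_ex k_meas intk.
  have int_diff : mu.-integrable setT (EFin \o (fun t => f t - k t)).
    exact: (integrableB measurableT intf intk).
  have d1 : `|phi y - phi w| <= C * (e / (2 * C + 1)).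
    rewrite -linearB; apply: le_trans (phiC _) _; rewrite ler_wpM2l//.
    rewrite L1_normRE; apply: le_trans fk.
    rewrite le_eqVlt; apply/orP; left; apply/eqP; apply: ae_Rintegral.
    + by apply: measurableT_comp => //; exact: L1_measurable.
    + by apply: measurableT_comp => //; exact: measurable_funB.
    + have h1 := L1_ae_lin (-1) w y.
      apply: filterS3 h1 wE yE => t e1 e2 e3 _.
      by rewrite addrC -scaleN1r e1// e2// e3// mulN1r addrC.
  have d2 : `|\int[mu]_t (f t * g0 t) - \int[mu]_t (k t * g0 t)| <=
      C * (e / (2 * C + 1)).
    rewrite -RintegralB//.
    under eq_Rintegral do rewrite -mulrBl.
    apply: le_trans (mul_bounded_norm _ mg0 gC) _ => //.
    by rewrite ler_wpM2l.
  rewrite (_ : _ - _ = (phi y - phi w) -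
    (\int[mu]_t (f t * g0 t) - \int[mu]_t (k t * g0 t))); last first.
    by rewrite (Pk _ wE); ring.
  apply: le_trans (ler_normB _ _) _; apply: le_trans (lerD d1 d2) _.
  rewrite (_ : _ + _ = e * ((2 * C) / (2 * C + 1))); last first.
    by field; rewrite gt_eqF.
  by rewrite ler_piMr ?(ltW e0)// ler_pdivrMr// mul1r lerDl.
have bP : forall (f : T -> R) (D : R), mf f -> (forall t, `|f t| <= D) -> P f.
  apply: bounded_measurable_ind.
  - move=> A mA y yA; rewrite (_ : y = ind A).
      rewrite -/(nu A) nuE// Rintegral_indicr//.
      apply: ae_Rintegral.
      + by apply: measurable_funM => //; exact: measurable_indic.
      + by apply: measurable_funM => //; exact: measurable_indic.
      + by apply: filterS gh => t /(_ I) -> _; rewrite mulrC.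
    apply: L1_ae_inj; apply: filterS2 yA (indE _ mA) => t e1 e2 _.
    by rewrite e1// e2.
  - move=> a f k D f_meas k_meas fD kD Pf Pk y yE.
    have intf := bounded_integrable f_meas fD.
    have intk := bounded_integrable k_meas kD.
    have [z zE] := L1_class_ex f_meas intf.
    have [w wE] := L1_class_ex k_meas intk.
    rewrite (_ : y = a *: z + w); last first.
      apply: L1_ae_inj; apply: filterS3 yE (L1_ae_lin a z w) (filterI zE wE).
      by move=> t e1 e2 [e3 e4] _; rewrite e1// e2// e3// e4.
    rewrite linearP /= (Pf _ zE) (Pk _ wE).
    have ifg := integrable_mul_bounded intf mg0 gC.
    have ikg := integrable_mul_bounded intk mg0 gC.
    rewrite -[a *: _]/(a * _) -RintegralZl// -RintegralD//; last exact: integrableZl ifg.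
    by apply: eq_Rintegral => t _; rewrite mulrDl mulrA.
  - move=> f D f_meas fD H; have intf := bounded_integrable f_meas fD.
    apply: Pclosed => // e e0.
    pose m := fine (mu setT).
    have m0 : 0 <= m by rewrite fine_ge0.
    have em0 : 0 < e / (m + 1) by rewrite divr_gt0// ltr_pwDr.
    have [k Pk [k_meas kD fk]] := H _ em0.
    have intk := bounded_integrable k_meas kD.
    exists k; split => //.
    apply: (@le_trans _ _ (\int[mu]_t (cst (e / (m + 1)) t))).
      apply: le_Rintegral => //.
      + by apply: integrable_norm; exact: (integrableB measurableT intf intk).
      + exact: (@bounded_integrable (cst (e / (m + 1))) `|e / (m + 1)|).
    rewrite Rintegral_cst// -/m mulrAC ler_pdivrMr ?ltr_pwDr//.
    by rewrite ler_wpM2l ?(ltW e0)// lerDl.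
have intx := L1_integrable x.
have [s [ints _ s_cvg]] := approximation_sfun_integrable measurableT intx.
have sP n : P (s n).
  have [D [_ sD]] := simple_bounded (s n).
  apply: (bP _ (D + 1)); first exact: measurable_funPT.
  by move=> t; apply: sD => //; rewrite ltrDl.
apply: (Pclosed x (L1_measurable x) intx) (ae_eq_refl _ _ _).
move=> e e0; move: s_cvg => /fine_cvgP[_] /cvgrPdist_lt /(_ _ e0)[N _ hN].
exists (s N); split; [exact: measurable_funPT|exact: ints|exact: sP|].
have := hN N (leqnn N); rewrite /= sub0r normrN => /ltW; apply: le_trans.
by apply: le_trans (ler_norm _).
Qed.

End L1_dual.

(** * Weak compactness of equi-integrable sets *)

Section weak_topology.
Context (R : realType) (E : normedModType R).

Lemma weak_continuous (phi : {linear E -> R^o}) : continuous phi ->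
  continuous (phi : weak_space E -> R).
Proof.
move=> cphi x; have [h _] := @weak_cvgP R E (nbhs (x : weak_space E)) x _.
exact: (h (fun _ H => H) _ cphi).
Qed.

(** How constraints on a set are carried to its weak closure: they are
    phrased as closed conditions on the values of one functional. *)
Lemma weak_closure_preimage (K : set E) (phi : {linear E -> R^o}) (D : set R) :
  continuous phi -> closed D -> (forall x, K x -> D (phi x)) ->
  forall x, closure (K : set (weak_space E)) x -> D (phi x).
Proof.
move=> cphi cD KD.
have cl : closed ((phi : weak_space E -> R) @^-1` D).
  by apply: closed_comp => // x _; exact: weak_continuous.
have sub : closure (K : set (weak_space E)) `<=`
    closure ((phi : weak_space E -> R) @^-1` D).
  by apply: closureS => x /KD.
by move=> x /sub/cl.
Qed.

End weak_topology.

Lemma fmap_ultra (T U : Type) (f : T -> U) (F : set_system T) :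
  UltraFilter F -> UltraFilter (f @ F).
Proof.
move=> UF; split; first exact: fmap_proper_filter.
move=> G PG FG; apply/seteqP; split => [B GB|]; last exact: FG.
have [//|FnB] := in_ultra_setVsetC (f @^-1` B) UF.
have GnB : G (~` B) by exact: FG.
by exfalso; apply: (@filter_not_empty _ G _); rewrite -(setICr B); exact: filterI.
Qed.

Section dunford_pettis.
Context (d : measure_display) (T : measurableType d) (R : realType).
Variable mu : {finite_measure set T -> \bar R}.
Local Notation mf := (measurable_fun [set: T]).

(** The norm of [x] is the value at [x] of the functional with density the
    sign of [x], and this functional is at most the norm everywhere. *)
Lemma weak_closure_L1_norm_le (K : set (L1 mu)) (C : R) :
  (forall x, K x -> `|x| <= C) ->
  forall x, closure (K : set (weak_space (L1 mu))) x -> `|x| <= C.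
Proof.
move=> KC x Kx.
pose s t : R := if 0 <= x t then 1 else -1.
have ms : mf s.
  apply: measurable_fun_ifT => //.
  by apply: measurable_fun_ler => //; exact: L1_measurable.
have s1 t : `|s t| <= 1 by rewrite /s; case: ifP; rewrite ?normrN normr1.
have [phi cphi phiE] := @bounded_pairing_functional _ _ _ mu _ _ ms s1.
have cl : closed [set r : R | r <= C] by exact: closed_le.
have := weak_closure_preimage cphi cl _ Kx.
rewrite phiE L1_normRE => h.
rewrite (_ : \int[mu]_t `|x t| = \int[mu]_t (x t * s t)).
  apply: h => y Ky /=; rewrite phiE; apply: le_trans (ler_norm _) _.
  apply: le_trans (mul_bounded_norm (L1_integrable y) ms s1) _.
  by rewrite mul1r -L1_normRE KC.
apply: eq_Rintegral => t _; rewrite /s; case: ifPn => [t0|].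
  by rewrite mulr1 ger0_norm.
by rewrite -ltNge mulrN1 => /ltr0_norm.
Qed.

(** The sufficient half of the Dunford-Pettis criterion. Along an ultrafilter
    on the weak closure of [K], the numbers [\int_A x] converge for every
    measurable [A]. Their limits depend on [A] additively, and absolutely
    continuously because equi-integrability is uniform over [K], so they are
    the integrals over [A] of some [x0] in L^1. The ultrafilter converges
    weakly to [x0]: this is tested on functionals with an indicator for
    density, and the others follow by uniform approximation of the density,
    the norms being bounded. *)
Lemma dunford_pettis (K : set (L1 mu)) (C : R) :
  (forall x, K x -> `|x| <= C) ->
  (forall e : R, 0 < e -> exists2 dl : R, 0 < dl & forall x A, K x ->
     measurable A -> (mu A < dl%:E)%E -> `|\int[mu]_(t in A) x t| <= e) ->
  precompact (K : set (weak_space (L1 mu))).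
Proof.
move=> KC Kac; rewrite precompactE; set K' := closure _.
have K'C x : K' x -> `|x| <= C by exact: weak_closure_L1_norm_le.
have K'ac (e : R) : 0 < e -> exists2 dl : R, 0 < dl & forall x A, K' x ->
     measurable A -> (mu A < dl%:E)%E -> `|\int[mu]_(t in A) x t| <= e.
  move=> e0; have [dl dl0 ac] := Kac _ e0; exists dl => // x A Kx mA Adl.
  have [phi cphi phiE] := set_integral_functional mu mA.
  rewrite -phiE.
  have cl : closed [set r : R | `|r| <= e].
    by apply: closed_comp (@closed_le _ _) => ? _; exact: norm_continuous.
  by apply: (weak_closure_preimage cphi cl _ Kx) => y Ky /=; rewrite phiE ac.
rewrite compact_ultra => F FU FK'.
have lim_ex (A : set T) : exists l : R, measurable A ->
    (\int[mu]_(t in A) (x : L1 mu) t) @[x --> F] --> l.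
  have [mA|nA] := pselect (measurable A); last by exists 0.
  have [phi cphi phiE] := set_integral_functional mu mA.
  have [D D0 phiD] := continuous_functional_bound cphi.
  have Fseg : (phi @ F) (`[- (D * C), D * C]%classic : set R).
    rewrite /nbhs/=; apply: (@filterS _ F _ K') FK' => x Kx /=.
    rewrite in_itv/= -ler_norml.
    by apply: le_trans (phiD x) _; rewrite ler_wpM2l// K'C.
  have := @segment_compact R (- (D * C)) (D * C).
  rewrite compact_ultra => /(_ (phi @ F) (fmap_ultra phi FU) Fseg)[l [_ Fl]].
  exists l => _; rewrite (_ : (fun x : L1 mu => _) = phi)//.
  by apply/funext => x; rewrite phiE.
have [nu nuE] := choice lim_ex.
have nuU A B : measurable A -> measurable B -> A `&` B = set0 ->
    nu (A `|` B) = nu A + nu B.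
  move=> mA mB AB; have mAB := measurableU _ _ mA mB.
  apply: (cvg_unique _ (nuE _ mAB)) => //.
  rewrite (_ : (fun x : L1 mu => _) = (fun x : L1 mu =>
      \int[mu]_(t in A) x t + \int[mu]_(t in B) x t)); last first.
    apply/funext => x; rewrite Rintegral_setU//.
      by apply: integrableS (L1_integrable x).
    by rewrite disj_set2E AB.
  by apply: cvgD; exact: nuE.
have nu_ac (e : R) : 0 < e -> exists2 dl : R, 0 < dl &
    forall A, measurable A -> (mu A < dl%:E)%E -> `|nu A| <= e.
  move=> e0; have [dl dl0 ac] := K'ac _ e0; exists dl => // A mA Adl.
  apply: (@closed_cvg _ _ _ _ (fun x : L1 mu => \int[mu]_(t in A) x t)
    [set r : R | `|r| <= e] _ _ _ (nuE _ mA)).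
    by apply: closed_comp (@closed_le _ _) => ? _; exact: norm_continuous.
  by apply: filterS FK' => x Kx; exact: ac.
have [h [inth nu_h]] := radon_nikodym_set_function nuU nu_ac.
have h_meas : mf h by exact: measurable_funPT.
have [x0 x0h] := L1_class_ex h_meas inth.
have Fx0 : F --> (x0 : weak_space (L1 mu)).
  apply/weak_cvgP => phi cphi.
  have [g [D [gD phiE]]] := L1_functional_repr cphi.
  pose P (k : T -> R) := (\int[mu]_t ((x : L1 mu) t * k t)) @[x --> F]
      --> \int[mu]_t (x0 t * k t).
  have Pg : P g.
    apply: (@bounded_measurable_ind R _ T P) (measurable_funPT g) gD.
    - move=> A mA; rewrite /P -Rintegral_indicr//.
      rewrite (_ : \int[mu]_(t in A) x0 t = nu A); last first.
        rewrite nu_h// (Rintegral_indicr mu x0 mA) (Rintegral_indicr mu h mA).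
        apply: ae_Rintegral.
        + by apply: measurable_funM; [exact: L1_measurable|exact: measurable_indic].
        + by apply: measurable_funM; [exact: h_meas|exact: measurable_indic].
        + by apply: filterS x0h => t /(_ I) ->.
      under eq_fun do rewrite -Rintegral_indicr//.
      exact: nuE.
    - move=> a f k B f_meas k_meas fB kB Pf Pk.
      have E (x : L1 mu) : \int[mu]_t (x t * (a * f t + k t)) =
          a * \int[mu]_t (x t * f t) + \int[mu]_t (x t * k t).
        have ixf := integrable_mul_bounded (L1_integrable x) f_meas fB.
        have ixk := integrable_mul_bounded (L1_integrable x) k_meas kB.
        rewrite -RintegralZl// -RintegralD//; last exact: integrableZl ixf.
        by apply: eq_Rintegral => t _; ring.
      rewrite /P E; under eq_fun do rewrite E.
      by apply: cvgD => //; apply: cvgM => //; exact: cvg_cst.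
    (* Replacing [f] by [k] moves every pairing by at most [e] times the norm,
       and the norm is at most [C] along the filter. *)
    - move=> f B f_meas fB H.
      have est (x : L1 mu) (k : T -> R) (e : R) : mf k ->
          (forall t, `|k t| <= B + e) -> (forall t, `|f t - k t| <= e) ->
          `|\int[mu]_t (x t * f t) - \int[mu]_t (x t * k t)| <= e * `|x|.
        move=> k_meas kB fk.
        have ixf := integrable_mul_bounded (L1_integrable x) f_meas fB.
        have ixk := integrable_mul_bounded (L1_integrable x) k_meas kB.
        rewrite -RintegralB//.
        under eq_Rintegral do rewrite -mulrBr.
        rewrite L1_normRE; apply: mul_bounded_norm => //.
          exact: L1_integrable.
        exact: measurable_funB.
      apply/cvgrPdist_le => e e0.
      pose D' := `|C| + `|x0| + 1.
      have D'0 : 0 < D' by rewrite ltr_pwDr// addr_ge0.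
      have e2 : 0 < e / 2 by rewrite divr_gt0.
      have e4 : 0 < e / (4 * D') by rewrite divr_gt0// mulr_gt0.
      have [k' Pk' [k'_meas k'B fk']] := H _ e4.
      move: Pk' => /cvgrPdist_le /(_ _ e2) h2.
      apply: (@filterS2 _ F _ _ _ _ _ h2 FK') => x xe Kx.
      rewrite (_ : _ - _ = (\int[mu]_t (x0 t * f t) - \int[mu]_t (x0 t * k' t))
        + (\int[mu]_t (x0 t * k' t) - \int[mu]_t (x t * k' t))
        - (\int[mu]_t (x t * f t) - \int[mu]_t (x t * k' t))); last by ring.
      apply: le_trans (ler_normB _ _) _; apply: le_trans (lerD (ler_normD _ _) (lexx _)) _.
      apply: le_trans (lerD (lerD (est x0 _ _ k'_meas k'B fk') xe)
        (est x _ _ k'_meas k'B fk')) _.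
      have xC : `|x| <= D'.
        by rewrite (le_trans (K'C _ Kx))// (le_trans (ler_norm _))// /D' -addrA lerDl addr_ge0.
      have x0C : `|x0| <= D'.
        by rewrite /D' addrAC lerDr addr_ge0.
      have E : e = e / (4 * D') * D' + e / 2 + e / (4 * D') * D'.
        by field; rewrite gt_eqF.
      rewrite [leRHS]E.
      by apply: lerD; [apply: lerD => //|]; apply: ler_wpM2l => //; exact: ltW.
  rewrite phiE (_ : (phi : L1 mu -> R) = fun x => \int[mu]_t (x t * g t))//.
  by apply/funext => x; rewrite phiE.
exists x0; split; last exact: Fx0.
apply: (@closed_cvg _ _ F _ (fun x : weak_space (L1 mu) => x) K') => //.
exact: closed_closure.
Qed.

End dunford_pettis.

(** * Distribution functions and rearrangements *)

Section layer_cake.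
Context (R : realType).

Definition count_below (u : \bar R) (N : nat) : R :=
  \sum_(n < N) ((n%:R%:E < u)%E : nat)%:R.

Lemma count_below_ge (r : R) (N : nat) : Num.min N%:R r <= count_below r%:E N.
Proof.
elim: N => [|N IH]; first by rewrite /count_below big_ord0 ge_min lexx.
rewrite /count_below big_ord_recr /= -/(count_below _ _) lte_fin ge_min.
have [Nr|rN] := ltP N%:R r; last first.
  by rewrite addr0; apply/orP; right; apply: le_trans IH; rewrite le_min rN/=.
apply/orP; left; rewrite -natr1 lerD2r; apply: le_trans IH.
by rewrite le_min lexx ltW.
Qed.

Lemma count_below_le_num (u : \bar R) (N : nat) : count_below u N <= N%:R.
Proof.
apply: le_trans (ler_sum _ (_ : forall i, true -> _ <= 1)) _.
  by move=> i _; rewrite lern1 leq_b1.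
by rewrite big_const_ord iter_addr_0.
Qed.

Lemma count_below_le (r : R) (N : nat) : 0 <= r -> count_below r%:E N <= r + 1.
Proof.
move=> r0; elim: N => [|N IH]; first by rewrite /count_below big_ord0 addr_ge0.
have := count_below_le_num r%:E N.+1.
rewrite /count_below big_ord_recr /= -/(count_below _ _) lte_fin.
have [Nr|rN] := ltP N%:R r; last by rewrite addr0.
by move/le_trans; apply; rewrite -natr1 lerD2r ltW.
Qed.

Lemma count_below_oo (N : nat) : count_below +oo%E N = N%:R.
Proof.
rewrite /count_below (eq_bigr (fun=> 1)); last by move=> i _; rewrite ltry.
by rewrite big_const_ord iter_addr_0.
Qed.

Let count_series (u : \bar R) : \bar R :=
  (\sum_(n <oo) ((n%:R%:E < u)%E : nat)%:R%:E)%E.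

Let count_seriesE u N : (\sum_(0 <= n < N) ((n%:R%:E < u)%E : nat)%:R%:E)%E =
  (count_below u N)%:E.
Proof. by rewrite sumEFin big_mkord. Qed.

Let count_below_le_series u N : ((count_below u N)%:E <= count_series u)%E.
Proof. by rewrite -count_seriesE; apply: nneseries_lim_ge => n _ _; rewrite lee_fin. Qed.

Let le_count_series u : (0 <= u)%E -> (u <= count_series u)%E.
Proof.
case: u => [r| |//]; rewrite ?lee_fin => r0.
  apply: le_trans (count_below_le_series _ (Num.trunc r).+1); rewrite lee_fin.
  apply: le_trans (count_below_ge _ _); rewrite le_min lexx andbT.
  exact/ltW/truncnS_gt.
rewrite leye_eq; apply/eqP/eq_infty => A.
apply: le_trans (count_below_le_series _ (Num.trunc A).+1).
by rewrite count_below_oo lee_fin; exact/ltW/truncnS_gt.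
Qed.

Let count_series_le u : (0 <= u)%E -> (count_series u <= u + 1)%E.
Proof.
case: u => [r| |//]; last by rewrite addye ?leey.
rewrite lee_fin => r0; apply: lime_le.
  by apply: is_cvg_nneseries => n _ _; rewrite lee_fin.
by apply: nearW => N; rewrite count_seriesE lee_fin count_below_le.
Qed.

Context (d : measure_display) (T : measurableType d).

(** A crude layer-cake formula that suffices for questions of finiteness: the
    number of integers [n >= 0] with [n < u] lies between [u] and [u + 1].
    The integral of [G] is then controlled by the measures of the countably
    many level sets [n < G]. *)
Lemma integral_finite_layers (mu : {measure set T -> \bar R}) (D : set T)
    (G : T -> \bar R) : measurable D -> (mu D < +oo)%E ->
  measurable_fun D G -> (forall t, D t -> (0 <= G t)%E) ->
  (\int[mu]_(t in D) G t < +oo)%E <->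
  (\sum_(n <oo) mu (D `&` [set t | n%:R%:E < G t]%E) < +oo)%E.
Proof.
move=> mD muD mG G0.
pose A n := D `&` [set t | n%:R%:E < G t]%E.
have mA n : measurable (A n) by exact: emeasurable_fun_o_infty.
pose W t := (\sum_(n <oo) (\1_(A n) t)%:E)%E : \bar R.
have WE t : D t -> W t = count_series (G t).
  move=> Dt; apply: eq_eseriesr => n _.
  rewrite indicE; congr (_%:R%:E); congr nat_of_bool.
  by apply/idP/idP; [move=> /set_mem[]|move=> h; apply/mem_set].
have mi n : measurable_fun D (fun t => (\1_(A n) t)%:E : \bar R).
  by apply/measurable_EFinP; exact: measurable_indic.
have E : (\sum_(n <oo) mu (A n) = \int[mu]_(t in D) W t)%E.
  rewrite integral_nneseries//.
  apply: eq_eseriesr => n _; rewrite integral_indic//.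
  by rewrite setIC setIA setIid.
have mW : measurable_fun D W by apply: ge0_emeasurable_sum.
have W0 t : (0 <= W t)%E by apply: nneseries_ge0 => n _ _; rewrite lee_fin.
rewrite E; split => fin.
- apply: (@le_lt_trans _ _ (\int[mu]_(t in D) (G t + 1))%E).
    apply: ge0_le_integral => //.
    + exact: emeasurable_funD.
    + by move=> t Dt; rewrite WE//; exact: count_series_le (G0 _ Dt).
  rewrite ge0_integralD// integral_cst// mul1e.
  exact: lte_add_pinfty.
- apply: le_lt_trans fin; apply: ge0_le_integral => //.
  by move=> t Dt; rewrite WE//; exact: le_count_series (G0 _ Dt).
Qed.

End layer_cake.

Section rearrangement_levels.
Context (d : measure_display) (T : measurableType d) (R : realType).
Variable mu : {finite_measure set T -> \bar R}.
Variable f : T -> R.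
Hypothesis f_meas : measurable_fun setT f.
Local Notation M := (fine (mu [set: T])).
Local Notation df := (distribution_function mu f).
Local Notation fstar := (decreasing_rearrangement mu f).

Lemma measurable_level (s : R) : measurable [set t | s < `|f t|].
Proof.
rewrite (_ : [set t | _] = (fun t => `|f t|) @^-1` `]s, +oo[).
  rewrite -[X in measurable X]setTI.
  have : measurable_fun setT (fun t => `|f t|) by exact: measurableT_comp.
  exact.
by apply/seteqP; split => t /=; rewrite in_itv/= andbT.
Qed.

Lemma distribution_function_fin (s : R) : df s \is a fin_num.
Proof. by apply: fin_num_measure; exact: measurable_level. Qed.

Lemma distribution_function_le_total (s : R) : (df s <= M%:E)%E.
Proof.
rewrite fineK ?fin_num_measure//; apply: le_measure => //; rewrite inE//.
exact: measurable_level.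
Qed.

Lemma distribution_function_nonincreasing (s s' : R) : s <= s' -> (df s' <= df s)%E.
Proof.
move=> ss; apply: le_measure; rewrite ?inE; [exact: measurable_level..|].
by move=> t /=; exact: le_lt_trans.
Qed.

Lemma decreasing_rearrangement_ge0 (x : R) : (0 <= fstar x)%E.
Proof.
rewrite leNgt; apply/negP => /ereal_inf_ltP[_ [s [s0 _] <-]].
by rewrite lte_fin ltNge s0.
Qed.

Lemma decreasing_rearrangement_le (s x : R) : 0 <= s -> (df s <= x%:E)%E ->
  (fstar x <= s%:E)%E.
Proof. by move=> s0 h; apply: ereal_inf_lbound; exists s. Qed.

(** The converse implication in the definition of the infimum holds because
    the distribution function is right continuous: [s < |f|] is the increasing
    union of the sets [s + 1/n < |f|]. *)
Lemma lt_decreasing_rearrangement (s x : R) : 0 <= s ->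
  (s%:E < fstar x)%E = (x%:E < df s)%E.
Proof.
move=> s0; apply/idP/idP; rewrite !ltNge; apply: contra.
  exact: decreasing_rearrangement_le.
move=> fx.
have lvl n : (df (s + n.+1%:R^-1) <= x%:E)%E.
  have /ereal_inf_ltP[_ [s' [_ h] <-]] : (fstar x < (s + n.+1%:R^-1)%:E)%E.
    by apply: le_lt_trans fx _; rewrite lte_fin ltrDl.
  rewrite lte_fin => ss; apply: le_trans h.
  exact/distribution_function_nonincreasing/ltW.
pose A n := [set t | s + n.+1%:R^-1 < `|f t|].
have mA n : measurable (A n) by exact: measurable_level.
have UA : \bigcup_n A n = [set t | s < `|f t|].
  apply/seteqP; split => t /=.
    by move=> [n _]; apply: lt_trans; rewrite ltrDl.
  move=> h; have [n hn] := ltr_add_invr h.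
  by exists n.
have := @nondecreasing_cvg_mu _ _ _ mu A mA.
rewrite UA => /(_ (measurable_level s)) cv.
have : mu \o A @ \oo --> df s.
  apply: cv => m n mn; apply/subsetPset => t; apply: le_lt_trans.
  by rewrite lerD2l lef_pV2 ?posrE// ler_nat.
move=> cv'; rewrite -(cvg_lim _ cv')//; apply: lime_le.
  by apply/cvg_ex; exists (df s).
by apply: nearW => n; exact: lvl.
Qed.

Lemma rearrangement_level_set (s : R) : 0 <= s ->
  (`[0, M[ `&` [set x | (s%:E < fstar x)%E] = `[0, fine (df s)[)%classic.
Proof.
move=> s0; apply/seteqP; split => x /=; rewrite !in_itv/= lt_decreasing_rearrangement//.
  move=> [/andP[-> _] h].
  by rewrite -lte_fin fineK// distribution_function_fin.
move=> /andP[-> /= xs].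
rewrite -[X in (_ < X)%E](fineK (distribution_function_fin s)) lte_fin; split => //.
apply: lt_le_trans xs _; rewrite -lee_fin fineK ?distribution_function_fin//.
exact: distribution_function_le_total.
Qed.

Lemma equimeasurable (s : R) : 0 <= s ->
  lebesgue_measure (`[0, M[ `&` [set x | (s%:E < fstar x)%E])%classic = df s.
Proof.
move=> s0; rewrite rearrangement_level_set// lebesgue_measure_itv/= lte_fin.
have h : 0 <= fine (df s) by rewrite fine_ge0.
rewrite -[RHS](fineK (distribution_function_fin s)).
by case: ltgtP h => //= [_ _|<-//]; rewrite sube0.
Qed.

End rearrangement_levels.

Section exponential_integrability.
Context (d : measure_display) (T : measurableType d) (R : realType).

Lemma lt_powRe (a c : R) (y : \bar R) : 1 < a -> (0 <= y)%E ->
  (c%:E < powRe a y)%E = (c < 1) || ((ln c / ln a)%:E < y)%E.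
Proof.
move=> a1 y0; have la : 0 < ln a by rewrite ln_gt0.
have [c1/=|c1/=] := ltP c 1.
  apply: (@lt_le_trans _ _ 1%E); first by rewrite lte_fin.
  rewrite -expeR0 lee_expeR mule_ge0// lee_fin; exact: ltW.
have c0 : 0 < c by exact: lt_le_trans c1.
rewrite -[X in X%:E](lnK c0) -[LHS]/(expeR (ln c)%:E < _)%E lte_expeR.
case: y y0 => [r r0| |//].
  by rewrite -EFinM !lte_fin ltr_pdivrMr.
by rewrite gt0_mulye ?lte_fin// !ltry.
Qed.

Variable mu : {finite_measure set T -> \bar R}.
Local Notation M := (fine (mu [set: T])).

(** By equimeasurability the integral of [a ^ h] over the space and that of
    [a] to the rearrangement of [h] over [[0, M[] have the same layers, which
    is all that their finiteness depends on. The layer [n = 0] is stated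
    separately because [ln 0] carries no information. *)
Lemma integral_powRe_rearrangement (h : T -> R) (a : R) :
  measurable_fun setT h -> (forall t, 0 <= h t) -> 1 < a ->
  (\int[lebesgue_measure]_(x in `[0%R, M[)
     powRe a (decreasing_rearrangement mu h x) < +oo)%E <->
  (\sum_(n <oo) mu [set t | ((n%:R < 1 :> R) || (ln n%:R / ln a < h t))%R] < +oo)%E.
Proof.
move=> mh h0 a1; have la : 0 < ln a by rewrite ln_gt0.
have fs0 := decreasing_rearrangement_ge0 mu h.
have lvl (c : R) : 1 <= c ->
    (`[0, M[ `&` [set x | (c%:E < powRe a (decreasing_rearrangement mu h x))%E] =
    `[0, M[ `&` [set x | ((ln c / ln a)%:E < decreasing_rearrangement mu h x)%E])%classic.
  move=> c1; congr (_ `&` _); apply/seteqP; split => x /=;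
    by rewrite lt_powRe// (ltNge c 1) c1.
have s0 (c : R) : 1 <= c -> 0 <= ln c / ln a.
  by move=> c1; rewrite divr_ge0 ?ln_ge0// ltW.
have mG : measurable_fun (`[0, M[ : set R)
    (fun x => powRe a (decreasing_rearrangement mu h x)).
  apply: (measurability _ (ErealGenOInfty.measurableE R)) => //.
  move=> /= _ [_ [c ->]] <-; rewrite preimage_itvoy.
  have [c1|c1] := leP 1 c.
    by rewrite lvl// rearrangement_level_set// s0.
  rewrite (_ : [set x | (c%:E < _)%E] = setT) ?setIT//.
  by apply/seteqP; split => x //= _; rewrite lt_powRe// c1.
rewrite integral_finite_layers//; last 2 first.
- by rewrite /= lebesgue_measure_itv/=; case: ifP => _; rewrite ?ltry// -EFinB ltry.
- by move=> x _; exact: expeR_ge0.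
rewrite (_ : (\sum_(n <oo) _)%E = (\sum_(n <oo)
  mu [set t | ((n%:R < 1 :> R) || (ln n%:R / ln a < h t))%R])%E)//.
apply: eq_eseriesr => n _; have [n1|n1] := leP 1 (n%:R : R).
  rewrite lvl//; apply: etrans (equimeasurable mu mh (s0 _ n1)) _.
  congr (mu _).
  by apply/seteqP; split => t /=; rewrite ger0_norm.
rewrite (_ : [set x | (n%:R%:E < _)%E] = setT); last first.
  by apply/seteqP; split => x //= _; rewrite lt_powRe// n1.
rewrite setIT (_ : [set t | (true || _)] = setT); last by apply/seteqP; split.
rewrite /= lebesgue_measure_itv/= lte_fin.
have M0 : 0 <= M by rewrite fine_ge0.
rewrite -[RHS]fineK ?fin_num_measure//.
by case: ltgtP M0 => //= [_ _|<-//]; rewrite sube0.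
Qed.

Lemma integral_powR_layers (h : T -> R) (a : R) :
  measurable_fun setT h -> (forall t, 0 <= h t) -> 1 < a ->
  (\int[mu]_t (a `^ h t)%:E < +oo)%E <->
  (\sum_(n <oo) mu [set t | ((n%:R < 1 :> R) || (ln n%:R / ln a < h t))%R] < +oo)%E.
Proof.
move=> mh h0 a1; rewrite integral_finite_layers//; last 3 first.
- by rewrite ltey_eq fin_num_measure.
- by apply/measurable_EFinP; apply: measurableT_comp (measurable_powRr _) mh.
- by move=> t _; rewrite lee_fin powR_ge0.
rewrite (_ : (\sum_(n <oo) _)%E = (\sum_(n <oo)
  mu [set t | ((n%:R < 1 :> R) || (ln n%:R / ln a < h t))%R])%E)//.
apply: eq_eseriesr => n _; rewrite setTI; congr (mu _).
apply/seteqP; split => t /=; rewrite -powRe_EFin ?(lt_trans ltr01)//;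
  by rewrite lt_powRe ?lee_fin// lte_fin.
Qed.

End exponential_integrability.

(** * Decay of the conjugate exponent: from (4) to (1) *)

Section inverse_square_series.
Context (R : realType).

(** Comparison with a telescoping sum: 1/k^2 is at most 2/k - 2/(k+1). *)
Lemma inverse_square_sum (N m : nat) : (0 < N)%N ->
  \sum_(N <= n < N + m) (n%:R ^- 2 : R) <= 2 / N%:R - 2 / (N + m)%:R.
Proof.
move=> N0; elim: m => [|m IH]; first by rewrite addn0 big_geq// subrr.
rewrite addnS big_nat_recr ?leq_addr//=.
set k := (N + m)%N in IH *; have k0 : 0 < k%:R :> R by rewrite ltr0n addn_gt0 N0.
apply: le_trans (lerD IH (lexx _)) _; rewrite -addrA lerD2l.
rewrite -subr_ge0 (_ : _ - _ = (k%:R - 1) / (k%:R ^+ 2 * (k%:R + 1))); last first.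
  by rewrite -natr1; field; rewrite !gt_eqF// addr_gt0.
apply: divr_ge0; first by rewrite subr_ge0 ler1n addn_gt0 N0.
by rewrite mulr_ge0 ?exprn_ge0 ?addr_ge0// ltW.
Qed.

Lemma inverse_square_tail_summable (u : nat -> \bar R) (N : nat) : (0 < N)%N ->
  (forall n, (0 <= u n)%E) -> (forall n, (u n < +oo)%E) ->
  (forall n, (N <= n)%N -> (u n <= (n%:R ^- 2)%:E)%E) ->
  (\sum_(n <oo) u n < +oo)%E.
Proof.
move=> N0 u0 uoo uN; rewrite (nneseries_split 0%N N)//.
apply: lte_add_pinfty.
  by apply: lte_sum_pinfty => n _; exact: uoo.
rewrite add0n; apply: (@le_lt_trans _ _ 2%:E); last by rewrite ltry.
apply: lime_le; first by apply: is_cvg_nneseries => n _ _; exact: u0.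
apply: nearW => m; have [Nm|/ltnW mN] := leqP N m; last first.
  by rewrite big_geq// lee_fin.
rewrite -(subnKC Nm); set j := (m - N)%N.
apply: (@le_trans _ _ (\sum_(N <= n < N + j) (n%:R ^- 2)%:E)%E).
  by rewrite big_nat [leRHS]big_nat; apply: lee_sum => n /andP[/uN].
rewrite sumEFin lee_fin; apply: le_trans (inverse_square_sum _ N0) _.
apply: (@le_trans _ _ (2 / N%:R)); first by rewrite lerBlDr lerDl divr_ge0.
by rewrite ler_pdivrMr ?ltr0n// ler_peMr// ler1n.
Qed.

End inverse_square_series.

Section conjugate_exponent.
Context (d : measure_display) (T : measurableType d) (R : realType).
Variables (mu : {finite_measure set T -> \bar R}) (p : exponent T R).
Local Notation M := (fine (mu [set: T])).
Local Notation h := (fun t => p t / (p t - 1)).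
Local Notation r := (fun t => (p t - 1) / p t).

Lemma measurable_expo : measurable_fun [set: T] p.
Proof. exact: measurable_funPT. Qed.

Lemma measurable_inv_fun (f : T -> R) : measurable_fun [set: T] f ->
  (forall t, 0 <= f t) -> measurable_fun [set: T] (fun t => (f t)^-1).
Proof.
move=> mf f0; rewrite (_ : (fun t => _) = (fun t => f t `^ (-1))).
  exact: measurableT_comp (measurable_powR _) mf.
by apply/funext => t; rewrite powR_inv1.
Qed.

Lemma measurable_conj : measurable_fun [set: T] h.
Proof.
apply: measurable_funM; first exact: measurable_expo.
apply: measurable_inv_fun.
  by apply: measurable_funB => //; exact: measurable_expo.
by move=> t; rewrite subr_ge0 expo_ge1.
Qed.

Lemma measurable_conj_inv : measurable_fun [set: T] r.
Proof.
apply: measurable_funM.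
  by apply: measurable_funB => //; exact: measurable_expo.
apply: measurable_inv_fun; first exact: measurable_expo.
by move=> t; rewrite ltW ?expo_gt0.
Qed.

Lemma conj_ge0 t : 0 <= h t.
Proof. by rewrite divr_ge0// ?subr_ge0 ?expo_ge1// ltW// expo_gt0. Qed.

Lemma conj_inv_ge0 t : 0 <= r t.
Proof. by rewrite divr_ge0// ?subr_ge0 ?expo_ge1// ltW// expo_gt0. Qed.

Lemma conj_inv_lt1 t : r t < 1.
Proof. by rewrite ltr_pdivrMr ?expo_gt0// mul1r gtrBl. Qed.

Lemma conj_inv_rearrangement_fin x :
  0 <= x -> decreasing_rearrangement mu r x \is a fin_num.
Proof.
move=> x0; rewrite ge0_fin_numE ?decreasing_rearrangement_ge0//.
apply: (@le_lt_trans _ _ 1%:E); last by rewrite ltry.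
apply: decreasing_rearrangement_le => //.
rewrite /distribution_function (_ : [set t | _] = set0) ?measure0//.
rewrite -subset0 => t /=; rewrite ger0_norm ?conj_inv_ge0//.
by rewrite ltNge ltW// conj_inv_lt1.
Qed.

Lemma conj_levels_vanish (e : R) : 0 < e ->
  exists s : R, forall s', s <= s' -> (mu [set t | (s' < h t)%R] < e%:E)%E.
Proof.
move=> e0; pose A (n : nat) := [set t | n%:R < h t].
have lvlE s : [set t | s < h t] = [set t | s < `|h t|].
  by apply/seteqP; split => t /=; rewrite ger0_norm ?conj_ge0.
have mA s : measurable [set t | s < h t].
  by rewrite lvlE; apply: measurable_level; exact: measurable_conj.
have A0 : \bigcap_n A n = set0.
  rewrite -subset0 => t /(_ (Num.trunc (h t)).+1 I); rewrite /A/=.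
  by rewrite ltNge => /negP; apply; apply/ltW/truncnS_gt.
have : mu \o A @ \oo --> 0%E.
  rewrite -(measure0 mu) -A0; apply: nonincreasing_cvg_mu => //.
  - by rewrite ltey_eq fin_num_measure//; exact: mA.
  - by move=> n; exact: mA.
  - by rewrite A0.
  - move=> m n mn; apply/subsetPset => t; apply: le_lt_trans.
    by rewrite ler_nat.
move=> /fine_cvgP[_] /cvgrPdist_lt /(_ _ e0)[N _ /(_ N (leqnn N))] /=.
rewrite sub0r normrN => lt; exists N%:R => s' Ns.
apply: (@le_lt_trans _ _ (mu (A N))).
  apply: le_measure; rewrite ?inE; [exact: mA..|].
  by move=> t; apply: le_lt_trans.
rewrite -[ltLHS]fineK ?fin_num_measure//; last exact: mA.
by rewrite lte_fin (le_lt_trans (ler_norm _)).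
Qed.

(** Condition (4) says that the distribution of [h] decays faster than any
    exponential. Let [m] be the measure of [s < h], and evaluate (4) at
    [x = M - m]: there the rearrangement of [r = 1/h] is at most [1/s], since
    [r] exceeds [1/s] only off the set [s < h]. Once [m] is small, (4) gives
    [m ^ (1/s) <= a ^ -2], so [m <= a ^ (- 2 s)]. The layer [n < a ^ h] is the
    set [s < h] for [s = ln n / ln a], so its measure is at most [n ^ -2],
    which is summable. *)
Lemma power_limit_exponential_integrability :
  (M - x) `^ fine (decreasing_rearrangement mu r x)
     @[x --> within `[0, M[ (nbhs M)] --> (0 : R) ->
  forall a : R, 1 < a ->
     (\int[lebesgue_measure]_(x in `[0%R, M[)
        powRe a (decreasing_rearrangement mu h x) < +oo)%E.
Proof.
move=> lim0 a a1; have la : 0 < ln a by rewrite ln_gt0.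
have a0 : 0 < a by exact: lt_trans a1.
have a2 : 0 < a ^- 2 by rewrite invr_gt0 exprn_gt0.
(* The bound [a ^ -2] is chosen so that the layers decay like [n ^ -2]. *)
have [dl dl0 near_M] : exists2 dl, 0 < dl & forall x, 0 <= x -> x < M -> M - x < dl ->
    (M - x) `^ fine (decreasing_rearrangement mu r x) <= a ^- 2.
  move: lim0 => /cvgrPdist_lt /(_ _ a2) /= [dl /= dl0 H]; exists dl => // x x0 xM Mx.
  have Hx1 : `|M - x| < dl by rewrite gtr0_norm// subr_gt0.
  have Hx2 : (`[0, M[ : set R)%classic x by rewrite /= in_itv/= x0.
  have := H x Hx1 Hx2; rewrite /= sub0r normrN => /ltW.
  exact: le_trans (ler_norm _).
have md : 0 < Num.min dl 1 by rewrite lt_min dl0 ltr01.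
have [s0 hs0] := conj_levels_vanish md.
apply/integral_powRe_rearrangement => //.
- exact: measurable_conj.
- exact: conj_ge0.
(* From [N] on, the level [ln n / ln a] is at least [s0]. *)
pose N := (Num.trunc (expR (`|s0| * ln a))).+2.
have NR : expR (`|s0| * ln a) < N%:R.
  by apply: lt_le_trans (truncnS_gt _) _; rewrite ler_nat.
have mlvl (s : R) : measurable [set t | s < h t].
  rewrite (_ : [set t | _] = [set t | s < `|h t|]).
    by apply: measurable_level; exact: measurable_conj.
  by apply/seteqP; split => t /=; rewrite ger0_norm ?conj_ge0.
apply: (@inverse_square_tail_summable _ _ N) => // [n|n Nn].
  apply: (@le_lt_trans _ _ (mu setT)); last by rewrite ltey_eq fin_num_measure.
  apply: le_measure; rewrite ?inE//.
  have [n1|n1] := ltP (n%:R : R) 1; last exact: mlvl.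
  by rewrite (_ : [set t | _] = setT)//; apply/seteqP.
have n1 : (1 < n)%N by exact: leq_trans Nn.
have nR1 : 1 < n%:R :> R by rewrite ltr1n.
have lnn : 0 < ln n%:R :> R by rewrite ln_gt0.
rewrite (_ : [set t | _] = [set t | ln n%:R / ln a < h t]); last first.
  by apply/seteqP; split => t /=; rewrite (ltNge _ 1) (ltW nR1).
set s := ln n%:R / ln a; have s_gt0 : 0 < s by rewrite divr_gt0.
have s0s : s0 <= s.
  apply: le_trans (ler_norm _) _; rewrite ler_pdivlMr// -ler_expR lnK ?posrE ?ltr0n ?(ltn_trans _ n1)//.
  by rewrite ltW// (lt_le_trans NR)// ler_nat.
have := hs0 _ s0s; set A := [set t | _].
have mA : measurable A by exact: mlvl.
have Afin : mu A \is a fin_num by rewrite fin_num_measure.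
rewrite -(fineK Afin) lte_fin lee_fin lt_min; set m := fine (mu A) => /andP[mdl m1].
have m0 : 0 <= m by exact: fine_ge0.
have [->|m_neq0] := eqVneq m 0; first by rewrite invr_ge0 exprn_ge0.
have m_gt0 : 0 < m by rewrite lt_neqAle eq_sym m_neq0.
have mM : m <= M.
  by rewrite /m fine_le ?fin_num_measure//; apply: le_measure; rewrite ?inE.
have rs : (decreasing_rearrangement mu r (M - m) <= (s^-1)%:E)%E.
  apply: decreasing_rearrangement_le; first by rewrite invr_ge0 ltW.
  rewrite /distribution_function; set B := [set t | _]; have mB : measurable B.
    by apply: measurable_level; exact: measurable_conj_inv.
  have AB : A `&` B = set0.
    rewrite -subset0 => t [/=]; rewrite /A /B /= => sh.
    rewrite ger0_norm ?conj_inv_ge0// -invf_div => /ltW.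
    have h0 : 0 < h t by exact: lt_trans sh.
    by rewrite lef_pV2 ?posrE// leNgt sh.
  rewrite EFinB !fineK ?fin_num_measure// leeBrDl ?fin_num_measure//.
  rewrite -measureU//; apply: le_measure; rewrite ?inE//.
  exact: measurableU.
have := near_M (M - m); rewrite subr_ge0 mM ltrBlDr ltrDl m_gt0 subKr mdl.
move=> /(_ isT isT isT); set rho := fine _ => mrho.
have rho_fin : decreasing_rearrangement mu r (M - m) \is a fin_num.
  by rewrite conj_inv_rearrangement_fin// subr_ge0.
have rhos : rho <= s^-1 by rewrite -lee_fin fineK.
have lnm : ln m <= 0 by rewrite ln_le0// ltW.
have h1 : rho * ln m <= - 2 * ln a.
  rewrite -ln_powR (le_trans (_ : _ <= ln (a ^- 2)))//.
    by rewrite ler_ln ?posrE// powR_gt0.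
  by rewrite lnV ?posrE ?exprn_gt0// lnXn// mulNr mulr_natl.
have h2 : s^-1 * ln m <= rho * ln m by rewrite ler_wnM2r.
have h3 : ln m <= - 2 * ln n%:R.
  have := le_trans h2 h1; rewrite mulrC ler_pdivrMr// => /le_trans; apply.
  by rewrite /s -mulrA [ln a * _]mulrC divfK// gt_eqF.
rewrite -ler_ln ?posrE ?invr_gt0 ?exprn_gt0 ?ltr0n ?(ltn_trans _ n1)//.
rewrite lnV ?posrE ?exprn_gt0 ?ltr0n ?(ltn_trans _ n1)// lnXn ?ltr0n ?(ltn_trans _ n1)//.
by rewrite -[ln n%:R *+ 2]mulr_natl -mulNr.
Qed.

End conjugate_exponent.

(** * Equi-integrability of the unit ball: from (1) to (2) *)

Section inclusion_bounds.
Context (d : measure_display) (T : measurableType d) (R : realType).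
Variables (mu : {finite_measure set T -> \bar R}) (p : exponent T R).
Local Notation M := (fine (mu [set: T])).
Local Notation h := (fun t => p t / (p t - 1)).

Lemma varL_measurable (y : varL mu p) : measurable_fun [set: T] y.
Proof. exact: measurable_ae_class. Qed.

Lemma modular_le1 (y : varL mu p) (s : R) : `|y| < s ->
  (modular mu p (fun t => (y t / s)%R) <= 1)%E.
Proof.
move=> /(inf_lt (luxemburg_set_neq0 (varLP y)))[r [r0 yr]] rs.
have s0 : 0 < s by exact: lt_trans rs.
apply: le_trans yr; apply: le_modular.
- exact/measurable_funZ/varL_measurable.
- exact/measurable_funZ/varL_measurable.
- move=> t; rewrite !normrM ler_wpM2l// !normfV lef_pV2 ?posrE ?normr_gt0 ?gt_eqF//.
  by rewrite !gtr0_norm// ltW.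
Qed.

Lemma modular_le1_integral (y : varL mu p) (s : R) (E : set T) :
  `|y| < s -> measurable E ->
  (\int[mu]_(t in E) (`|y t / s| `^ p t)%:E <= 1)%E.
Proof.
move=> ys mE; apply: le_trans (modular_le1 ys).
apply: ge0_subset_integral => //.
exact/measurable_modular/measurable_funZ/varL_measurable.
Qed.

(** Since [p >= 1], [u <= 1 + u ^ p]; this is applied to [u = |y| / s] for [s]
    just above the norm of [y], where the modular is at most 1. *)
Lemma inclusion_norm_le (y : varL mu p) :
  `|inclusion mu p y| <= (M + 1) * `|y|.
Proof.
have M0 : 0 <= M by rewrite fine_ge0.
have M1 : 0 < M + 1 by rewrite ltr_pwDr.
apply/ler_addgt0Pl => e e0.
pose s := `|y| + e / (M + 1).
have ys : `|y| < s by rewrite ltrDl divr_gt0.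
have s0 : 0 < s by rewrite (le_lt_trans _ ys).
rewrite (_ : e + _ = s * (M + 1)); last by rewrite /s; field; rewrite gt_eqF.
rewrite L1_normRE -lee_fin /Rintegral fineK; last first.
  exact: (integrable_fin_num measurableT
    (integrable_norm (L1_integrable (inclusion mu p y)))).
have my := varL_measurable y.
have mys : measurable_fun [set: T] (fun t => y t / s) by exact: measurable_funZ.
apply: (@le_trans _ _ (\int[mu]_t (s%:E * (1 + (`|y t / s| `^ p t)%:E)))%E).
  apply: ge0_le_integral => //.
  - by apply/measurable_EFinP; exact: measurableT_comp.
  - by apply: emeasurable_funM => //; apply: emeasurable_funD => //; exact: measurable_modular.
  move=> t _; rewrite -EFinD -EFinM lee_fin mulrC -ler_pdivrMr//.
  rewrite -[s in _ / s](gtr0_norm s0) -normf_div.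
  set u := `|_|; have [u1|u1] := leP u 1.
    by rewrite (le_trans u1)// lerDl powR_ge0.
  by rewrite (@le_trans _ _ (u `^ p t)) ?lerDr// le1r_powR ?expo_ge1// ltW.
rewrite ge0_integralZl_EFin//; [|by move=> t _; rewrite adde_ge0// lee_fin powR_ge0
  |by apply: emeasurable_funD => //; exact: measurable_modular|exact: ltW].
rewrite EFinM lee_wpmul2l//; first by rewrite lee_fin ltW.
rewrite ge0_integralD//; last exact: measurable_modular.
rewrite EFinD fineK ?fin_num_measure// integral_cst// mul1e leeD2l//.
exact: modular_le1_integral.
Qed.

(** A weak form of Young's inequality, by comparing [u] with the threshold
    [b ^ h]. Above it, [u ^ (p - 1)] is at least [b ^ p], hence at least [b],
    and then [u] is dominated by its p-th power. *)
Lemma conj_threshold (b u : R) (t : T) : 1 < b -> 0 <= u -> 1 < p t ->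
  u <= b^-1 * u `^ p t + b `^ h t.
Proof.
move=> b1 u0 p1; have b0 : 0 < b by exact: lt_trans b1.
have q0 : 0 < p t - 1 by rewrite subr_gt0.
have [ub|bu] := leP u (b `^ h t).
  by rewrite (le_trans ub)// lerDr mulr_ge0 ?powR_ge0// invr_ge0 ltW.
rewrite (@le_trans _ _ (b^-1 * u `^ p t)) ?lerDl ?powR_ge0// ler_pdivlMl//.
have up : 0 < u by apply: le_lt_trans bu; exact: powR_ge0.
rewrite (_ : u `^ p t = u `^ (p t - 1) * u); last first.
  rewrite -{3}(powRr1 u0) -powRD ?subrK//.
  by rewrite (gt_eqF up) implybT.
rewrite ler_pM2r//.
apply: (@le_trans _ _ ((b `^ h t) `^ (p t - 1))).
  rewrite -powRrM divfK ?gt_eqF//.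
  by rewrite -[X in X <= _](powRr1 (ltW b0)) ler_powR ?ltW.
by rewrite ge0_ler_powR ?nnegrE ?powR_ge0 ?ltW.
Qed.

Hypothesis p_gt1 : {ae mu, forall t, 1 < p t}.

Lemma integral_conj_threshold (b : R) (y : varL mu p) (E : set T) :
  1 < b -> `|y| <= 1 -> measurable E ->
  (\int[mu]_(t in E) `|y t|%:E <=
     2%:E * (b^-1%:E + \int[mu]_(t in E) (b `^ h t)%:E))%E.
Proof.
move=> b1 y1 mE; have b0 : 0 < b by exact: lt_trans b1.
have my := varL_measurable y.
(* The modular of [y / s] is known to be at most 1 only for [s] strictly above
   the norm of [y], hence the factor 2. *)
have y2 : `|y| < 2 by rewrite (le_lt_trans y1)// ltr1n.
have mh : measurable_fun [set: T] (fun t => (b `^ h t)%:E).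
  apply/measurable_EFinP; apply: measurableT_comp (measurable_powRr _) _.
  exact: measurable_conj.
have my2 : measurable_fun [set: T] (fun t => (`|y t / 2| `^ p t)%:E).
  exact/measurable_modular/measurable_funZ.
have K0 t : 0 <= b^-1 * `|y t / 2| `^ p t + b `^ h t.
  by rewrite addr_ge0 ?mulr_ge0 ?powR_ge0// invr_ge0 ltW.
have KE t : (2 * (b^-1 * `|y t / 2| `^ p t + b `^ h t))%:E =
    (2%:E * (b^-1%:E * (`|y t / 2| `^ p t)%:E + (b `^ h t)%:E))%E by [].
have mK : measurable_fun setT
    (fun t => b^-1%:E * (`|y t / 2| `^ p t)%:E + (b `^ h t)%:E)%E.
  by apply: emeasurable_funD => //; apply: emeasurable_funM.
apply: (@le_trans _ _ (\int[mu]_(t in E)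
    (2%:E * (b^-1%:E * (`|y t / 2| `^ p t)%:E + (b `^ h t)%:E)))%E).
  apply: ae_ge0_le_integral => //.
  - apply: measurable_funTS; apply/measurable_EFinP.
    exact: measurableT_comp.
  - by move=> t _; rewrite -KE lee_fin mulr_ge0.
  - by apply: measurable_funTS; apply: emeasurable_funM.
  - apply: filterS p_gt1 => t pt _; rewrite -KE lee_fin.
    rewrite mulrC -ler_pdivrMr// -[X in _ / X](@ger0_norm _ 2)// -normf_div.
    exact: conj_threshold.
rewrite ge0_integralZl_EFin//; last 2 first.
- by move=> t _; rewrite -[X in (_ <= X)%E]/((b^-1 * `|y t / 2| `^ p t + b `^ h t)%:E) lee_fin.
- exact: measurable_funTS.
rewrite lee_wpmul2l ?lee_fin// ge0_integralD//; last 4 first.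
- by move=> t _; rewrite -EFinM lee_fin mulr_ge0 ?powR_ge0// invr_ge0 ltW.
- by apply: measurable_funTS; apply: emeasurable_funM.
- by move=> t _; rewrite lee_fin powR_ge0.
- exact: measurable_funTS.
apply: leeD2r; rewrite ge0_integralZl_EFin//; last 2 first.
- exact: measurable_funTS.
- by rewrite invr_ge0 ltW.
rewrite -[leRHS]mule1; apply: lee_wpmul2l; first by rewrite lee_fin invr_ge0 ltW.
exact: modular_le1_integral.
Qed.

(** For [y] in the unit ball, the integral of [|y|] over [A] is at most
    [2/b] plus twice the integral of [b ^ h] over [A]. With [b] large and then
    [A] small, this makes the image of the ball equi-integrable. *)
Lemma exponential_integrability_weakly_compact :
  (forall a : R, 1 < a -> (\int[mu]_t (a `^ h t)%:E < +oo)%E) ->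
  weakly_compact (inclusion mu p).
Proof.
move=> hint; apply: (@dunford_pettis _ _ _ mu _ (M + 1)).
  move=> _ [y /= y1 <-]; apply: le_trans (inclusion_norm_le y) _.
  by rewrite ler_piMr// addr_ge0// fine_ge0.
move=> e e0; pose b := 2 + 4 / e.
have b1 : 1 < b by rewrite /b; have := divr_gt0 (ltr0n R 4) e0; lra.
have b0 : 0 < b by exact: lt_trans b1.
have be : b^-1 <= e / 4.
  rewrite -[e / 4]invrK lef_pV2 ?posrE ?invr_gt0 ?divr_gt0// invf_div.
  by rewrite /b lerDr.
have mh : measurable_fun [set: T] (fun t => b `^ h t).
  by apply: measurableT_comp (measurable_powRr _) _; exact: measurable_conj.
have ih : mu.-integrable setT (EFin \o (fun t => b `^ h t)).
  apply/integrableP; split; first exact/measurable_EFinP.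
  by under eq_integral do rewrite /= ger0_norm ?powR_ge0//; exact: hint.
have e4 : 0 < e / 4 by rewrite divr_gt0.
have [dl [dl0 ac]] := integral_normr_continuous ih e4.
exists dl => // _ A [y /= y1 <-] mA Adl.
have iyA : mu.-integrable A (EFin \o inclusion mu p y).
  by apply: integrableS (L1_integrable _).
apply: le_trans (le_normr_Rintegral mA iyA) _.
have ihA : mu.-integrable A (EFin \o (fun t => b `^ h t)) by exact: integrableS ih.
have := integral_conj_threshold b1 y1 mA.
have := ac A mA Adl; under eq_Rintegral do rewrite ger0_norm ?powR_ge0//.
rewrite -[X in (_ <= _ * (_ + X))%E]fineK; last exact: integrable_fin_num ihA.
rewrite -[X in (X <= _)%E]fineK; last exact: (integrable_fin_num mA (integrable_norm iyA)).
rewrite -EFinD -EFinM lee_fin -/(Rintegral _ _ _) -/(Rintegral _ _ _) => h1 h2.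
apply: le_trans h2 _; lra.
Qed.

End inclusion_bounds.

(** * Weak compactness and disjoint sequences: from (2) to (3) *)

Section varL_classes.
Context (d : measure_display) (T : measurableType d) (R : realType).
Variables (mu : {measure set T -> \bar R}) (p : exponent T R).

Lemma varL_class_ex (f : T -> R) : varLfun mu p f ->
  exists2 x : varL mu p, (x : T -> R) = f %[ae mu] & `|x| = luxemburg mu p f.
Proof.
move=> vf; have mf := vf.1.
pose f' : {mfun T >-> R} := mfun_Sub (mem_set mf).
pose q : {mfun_ mu, T >-> R} := \pi_{mfun_ mu, T >-> R}%qT f'.
have qf : (q : T -> R) = f %[ae mu] by exact: repr_ae.
have mq : measurable_fun setT q by exact: measurable_ae_class.
have q1 : q \in varL_pred mu p.
  apply/varL_predP; apply: (ae_varLfun mf mq _ vf).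
  by apply: filterS qf => t + It => /(_ It).
exists (VarL q1); first exact: qf.
exact: (ae_luxemburg p mq mf qf).
Qed.

Lemma modular_norm (f : T -> R) (r : R) :
  modular mu p (fun t => `|f t| / r) = modular mu p (fun t => f t / r).
Proof.
by apply: eq_integral => t _; rewrite !normrM normr_id.
Qed.

Lemma luxemburg_norm (f : T -> R) :
  luxemburg mu p (fun t => `|f t|) = luxemburg mu p f.
Proof.
by apply: (congr1 inf); apply/funext => r; rewrite /mkset (modular_norm f r).
Qed.

Lemma varLfun_norm (f : T -> R) : varLfun mu p f ->
  varLfun mu p (fun t => `|f t|).
Proof.
move=> [mf [r r0 fr]]; split; first exact: measurableT_comp.
exists r; first exact: r0.
by rewrite (modular_norm f r).
Qed.

End varL_classes.

Lemma linear_span_mem (R : realType) (E : lmodType R) (f : nat -> E) n :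
  linear_span f (f n).
Proof.
exists n.+1, (fun i => (i == n)%:R); rewrite big_ord_recr/= eqxx scale1r.
by rewrite big1 ?add0r// => i _; rewrite ltn_eqF ?scale0r.
Qed.

Lemma linear_span0 (R : realType) (E : lmodType R) (f : nat -> E) :
  linear_span f 0.
Proof. by exists 0%N, (fun=> 0); rewrite big_ord0. Qed.

(** Continuity at 0 of the inverse gives a ball around 0 that it maps into the
    open unit ball; an image of a unit vector cannot lie in it. *)
Lemma iso_onto_image_bounded_below (R : realType) (E F : normedModType R)
    (A : {linear E -> F}) (S : set E) : S 0 -> iso_onto_image A S ->
  exists2 c : R, 0 < c & forall x, S x -> `|x| = 1 -> c <= `|A x|.
Proof.
move=> S0 [_ [g gA cg]].
have g0 : g 0 = 0 by rewrite -[in LHS](linear0 A) gA// inE.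
have AS0 : (A @` S) 0 by exists 0; rewrite ?linear0.
have /subspace_continuousP/(_ 0 AS0) := cg.
rewrite /from_subspace g0 => /cvgr0_norm_lt/(_ 1 ltr01) /nbhs_norm0P[c /= c0 H].
exists c => // x Sx x1; rewrite leNgt; apply/negP => Ax.
have /= := H (A x) Ax (imageP A Sx).
by rewrite gA ?inE// x1 ltxx.
Qed.

Section weakly_compact_dss.
Context (d : measure_display) (T : measurableType d) (R : realType).
Variables (mu : {finite_measure set T -> \bar R}) (p : exponent T R).

Lemma measurable_support (y : varL mu p) : measurable [set t | y t != 0].
Proof.
rewrite (_ : [set t | _] = ~` (y @^-1` [set 0])).
  apply: measurableC; rewrite -[X in measurable X]setTI.
  by have := varL_measurable y; apply.
by apply/seteqP; split => t /= /eqP.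
Qed.

(** A point of infinitely many supports lies in two of them, where the two
    functions are not disjoint. *)
Lemma disjoint_supports_limsup_null (f : nat -> varL mu p) :
  (forall m n, m <> n -> varL_disjoint mu p (f m) (f n)) ->
  mu (\bigcap_N \bigcup_(n >= N) [set t | f n t != 0]) = 0%E.
Proof.
move=> disj; set Z := \bigcap_N _.
have mE n : measurable [set t | f n t != 0] by exact: measurable_support.
have mZ : measurable Z.
  apply: bigcap_measurable => [|N _]; first by exists 0%N.
  exact: bigcup_measurable.
apply/(measure_negligible mZ).
have : {ae mu, forall t m n, m <> n -> Num.min `|f m t| `|f n t| = 0}.
  apply/ae_foralln => m; apply/ae_foralln => n.
  have [->|/eqP mn] := eqVneq m n; first exact: aeW.
  by apply: filterS (disj _ _ mn) => t h _.
apply: negligibleS => t Zt /= H.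
have [n _ fn] := Zt 0%N I; have [m /= nm fm] := Zt n.+1 I.
have mn : m <> n by move=> e; rewrite e ltnn in nm.
have /eqP := H m n mn; rewrite /Num.min; case: ifP => _; rewrite normr_eq0.
  by apply/negP.
by apply/negP.
Qed.

(** On the closed span of disjoint normalized [f n], an isomorphism bounds the
    L^1 norms of the [f n] below by some [c > 0]. The functions [|f n|] lie in
    the unit ball too, so by weak compactness they have a weak cluster point
    [z] in L^1. Let [F N] be the union of the supports of the [f n] with
    [n >= N]. For those [n] the integral of [|f n|] over [F N] is at least [c],
    so that of [z] is at least [c] for every [N]; but the measure of [F N]
    tends to 0, a contradiction. *)
Lemma weakly_compact_disjointly_strictly_singular :
  weakly_compact (inclusion mu p) ->
  disjointly_strictly_singular (varL_disjoint mu p) (inclusion mu p).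
Proof.
rewrite /weakly_compact precompactE; set K' := closure _ => cK.
move=> [f [f1 disj iso]].
have [c c0 below] := iso_onto_image_bounded_below
  (subset_closure (linear_span0 f)) iso.
have fc n : c <= `|inclusion mu p (f n)|.
  by apply: below; [exact/subset_closure/linear_span_mem|exact: f1].
pose E n := [set t | f n t != 0].
have mE n : measurable (E n) by exact: measurable_support.
pose F N := \bigcup_(n >= N) E n.
have mF N : measurable (F N) by exact: bigcup_measurable.
have abs_ex n : exists y : varL mu p,
    (y : T -> R) = (fun t => `|f n t|) %[ae mu] /\ `|y| <= 1.
  have [y yE y1] := varL_class_ex (varLfun_norm (varLP (f n))).
  have nE : luxemburg mu p (f n) = 1 by exact: (f1 n).
  by exists y; split; [exact: yE|rewrite y1 (luxemburg_norm mu p (f n)) nE].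
have [y yE] := choice abs_ex.
pose x n : weak_space (L1 mu) := inclusion mu p (y n).
have xK n : K' (x n).
  by apply: subset_closure; exists (y n) => //; exact: (yE n).2.
have xF : (x @ \oo) K' by exists 0%N => // n _; exact: xK.
have [z [_ z_cl]] := cK _ (fmap_proper_filter x _) xF.
have zc N : c <= \int[mu]_(t in F N) (z : L1 mu) t.
  have [phi cphi phiE] := set_integral_functional mu (mF N).
  rewrite -phiE.
  have cl : closed [set r : R | c <= r] by exact: closed_ge.
  apply: (@weak_closure_preimage _ _ (x @` [set n | (N <= n)%N]) phi _ cphi cl).
    move=> _ [n /= Nn <-]; rewrite phiE.
    apply: le_trans (fc n) _; rewrite L1_normRE le_eqVlt.
    apply/orP; left; apply/eqP; rewrite (Rintegral_indicr mu _ (mF N)).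
    have my := L1_measurable (inclusion mu p (y n)).
    apply: ae_Rintegral.
    - by apply: measurableT_comp => //; exact: L1_measurable.
    - by apply: measurable_funM; [exact: my|exact: measurable_indic].
    - apply: filterS (yE n).1 => t /(_ I) yt _; rewrite indicE yt.
      have [_|] := boolP (t \in F N); first by rewrite mulr1.
      rewrite notin_setE mulr0 => nF; have [fnt|fnt] := eqVneq (f n t) 0.
        by rewrite [X in `|X|]fnt normr0.
      by exfalso; apply: nF; exists n.
  move: z_cl; rewrite clusterE; apply.
  by exists N => // n Nn; exists n.
have muF : mu \o F @ \oo --> 0%E.
  rewrite -(disjoint_supports_limsup_null disj); apply: nonincreasing_cvg_mu => //.
  - by rewrite ltey_eq fin_num_measure.
  - by apply: bigcap_measurable => [|N _ //]; exists 0%N.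
  - move=> m n mn; apply/subsetPset => t [k /= nk Ek].
    by exists k => //=; exact: leq_trans nk.
have [dl [dl0 ac]] := integral_normr_continuous (L1_integrable (z : L1 mu)) c0.
move: muF => /fine_cvgP[_] /cvgrPdist_lt /(_ _ dl0)[N _ /(_ N (leqnn N))] /=.
rewrite sub0r normrN => FN.
have /ac : measurable (F N) by [].
rewrite -[X in (X < _)%E -> _]fineK ?fin_num_measure// lte_fin.
move=> /(_ (le_lt_trans (ler_norm _) FN)).
apply/negP; rewrite -leNgt; apply: le_trans (zc N) _.
apply: le_trans (ler_norm _) _; apply: le_normr_Rintegral => //.
by apply: integrableS (L1_integrable _).
Qed.

End weakly_compact_dss.

(** * Disjoint sequences of indicators: from (3) to (4) *)

Section bounded_below_operators.
Context (R : realType) (E F : normedModType R).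
Variables (A : {linear E -> F}) (K c : R) (L : set E).
Hypothesis AK : forall x, `|A x| <= K * `|x|.
Hypothesis c0 : 0 < c.
Hypothesis LB : forall x y, L x -> L y -> L (x - y).
Hypothesis Lc : forall x, L x -> c * `|x| <= `|A x|.

Lemma closure_bounded_below x y : closure L x -> closure L y ->
  c * `|x - y| <= `|A x - A y|.
Proof.
move=> Lx Ly; apply/ler_addgt0Pl => e e0.
pose K' := `|K| + c; have K'0 : 0 < K' by rewrite ltr_wpDl.
have AK' z : `|A z| <= `|K| * `|z|.
  by apply: le_trans (AK z) _; rewrite ler_wpM2r// ler_norm.
have e1 : 0 < e / (2 * K') by rewrite divr_gt0// mulr_gt0.
have [x' [Lx' xx']] := Lx _ (nbhsx_ballx x _ e1).
have [y' [Ly' yy']] := Ly _ (nbhsx_ballx y _ e1).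
rewrite -ball_normE /= in xx' yy'.
have h1 : `|x - y| <= `|x - x'| + (`|x' - y'| + `|y - y'|).
  by rewrite (distrC y) (le_trans (ler_distD x' _ _))// lerD2l ler_distD.
have h2 : `|A x' - A y'| <= `|A (x - x')| + (`|A x - A y| + `|A (y - y')|).
  rewrite (le_trans (ler_distD (A x) _ _))// !linearB (distrC (A x')) lerD2l.
  exact: ler_distD.
have h3 : c * `|x' - y'| <= `|A x' - A y'| by rewrite -linearB; exact/Lc/LB.
have kx : `|A (x - x')| <= `|K| * (e / (2 * K')).
  by rewrite (le_trans (AK' _))// ler_wpM2l// ltW.
have ky : `|A (y - y')| <= `|K| * (e / (2 * K')).
  by rewrite (le_trans (AK' _))// ler_wpM2l// ltW.
have cx : c * `|x - x'| <= c * (e / (2 * K')) by rewrite ler_pM2l// ltW.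
have cy : c * `|y - y'| <= c * (e / (2 * K')) by rewrite ler_pM2l// ltW.
have h4 := ler_wpM2l (ltW c0) h1; rewrite !mulrDr in h4.
have eE : e = 2 * (`|K| * (e / (2 * K'))) + 2 * (c * (e / (2 * K'))).
  by rewrite -mulrDr -mulrDl -/K'; field; rewrite gt_eqF.
by rewrite eE; lra.
Qed.

(** The lower bound passes to the closure, where it makes the operator
    injective with a Lipschitz inverse. *)
Lemma bounded_below_iso_onto_image : iso_onto_image A (closure L).
Proof.
split.
  apply: continuous_subspaceT; apply/linear_bounded_continuous/linear_boundedP.
  exists K; split; first exact: num_real.
  by move=> k Kk x; apply: le_trans (AK x) _; rewrite ler_wpM2r// ltW.
have g_ex (y : F) : exists x, (A @` closure L) y -> closure L x /\ A x = y.
  have [[x Lx Axy]|] := pselect ((A @` closure L) y); first by exists x.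
  by exists 0.
have [g gE] := choice g_ex.
have gA : {in closure L, cancel A g}.
  move=> x; rewrite inE => Lx; have [Lg Ag] := gE (A x) (imageP _ Lx).
  apply/eqP; rewrite -subr_eq0 -normr_le0.
  have := closure_bounded_below Lg Lx; rewrite Ag subrr normr0.
  by rewrite pmulr_rle0.
exists g => //; apply/subspace_continuousP => y Ay.
apply/cvgrPdist_lt => e e0; rewrite /from_subspace.
have ce : 0 < c * e by rewrite mulr_gt0.
have := nbhsx_ballx y _ ce; rewrite -ball_normE /= => nb.
apply: filterS nb => z /= yz Az.
have [Lgy Agy] := gE _ Ay; have [Lgz Agz] := gE _ Az.
rewrite -(ltr_pM2l c0); apply: le_lt_trans yz.
by have := closure_bounded_below Lgy Lgz; rewrite Agy Agz.
Qed.

End bounded_below_operators.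

Section disjoint_sequences.
Context (d : measure_display) (T : measurableType d) (R : realType).
Variables (mu : {finite_measure set T -> \bar R}) (p : exponent T R).
Local Notation A := (inclusion mu p).

Lemma linear_spanB (E : lmodType R) (f : nat -> E) x y :
  linear_span f x -> linear_span f y -> linear_span f (x - y).
Proof.
move=> [n [a ->]] [m [b ->]].
exists (maxn n m), (fun i => (if (i < n)%N then a i else 0) -
  (if (i < m)%N then b i else 0)).
have ext k (e : nat -> R) N : (k <= N)%N -> \sum_(i < k) e i *: f i =
    \sum_(i < N) (if (i < k)%N then e i else 0) *: f i.
  move=> kN; rewrite (big_ord_widen _ (fun i => e i *: f i) kN) big_mkcond/=.
  by apply: eq_bigr => i _; case: ifP => _; rewrite ?scale0r.
rewrite (ext n a _ (leq_maxl n m)) (ext m b _ (leq_maxr n m)) -sumrB.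
by apply: eq_bigr => i _; rewrite scalerBl.
Qed.

Lemma varL_disjoint0 (x : varL mu p) : varL_disjoint mu p 0 x.
Proof.
have := @ae_class0 _ _ _ mu; apply: filterS => t /(_ I) e.
by rewrite [X in `|X|]e normr0 min_l.
Qed.

Lemma varL_disjoint_lin a (x y z : varL mu p) : varL_disjoint mu p x z ->
  varL_disjoint mu p y z -> varL_disjoint mu p (y + a *: x) z.
Proof.
have h1 := @ae_classD _ _ _ mu (y : {mfun_ mu, T >-> R}) (a *: (x : {mfun_ mu, T >-> R})).
have h2 := @ae_classZ _ _ _ mu a (x : {mfun_ mu, T >-> R}).
move=> xz yz; apply: filterS3 (filterI xz yz) h1 h2 => t [e1 e2] /(_ I) e3 /(_ I) e4.
rewrite [X in Num.min `|X|]e3 /= e4.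
have [->|z0] := eqVneq (z t) 0; first by rewrite normr0 min_r.
have zz : `|z t| <> 0 by apply/eqP; rewrite normr_eq0.
have v0 (u : R) : Num.min `|u| `|z t| = 0 -> u = 0.
  by rewrite /Num.min; case: ifP => // _ /eqP; rewrite normr_eq0 => /eqP.
by rewrite (v0 _ e1) (v0 _ e2) mulr0 addr0 normr0 min_l.
Qed.

Lemma inclusion_disjoint_norm a (x z : varL mu p) : varL_disjoint mu p x z ->
  `|A (x + a *: z)| = `|A x| + `|a| * `|A z|.
Proof.
move=> xz; rewrite linearD linearZ /= !L1_normRE.
have ix := integrable_norm (L1_integrable (A x)).
have iz := integrable_norm (L1_integrable (A z)).
rewrite -RintegralZl// -RintegralD//; last exact: (integrableZl measurableT `|a| iz).
have mx := L1_measurable (A x); have mz := L1_measurable (A z).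
apply: ae_Rintegral.
- by apply: measurableT_comp => //; exact: L1_measurable.
- apply: measurable_funD; first exact: measurableT_comp.
  by apply: measurable_funM => //; exact: measurableT_comp.
- apply: filterS3 xz (L1_aeD (A x) (a *: A z)) (L1_aeZ a (A z)).
  move=> t e1 e2 e3 _; rewrite e2//= e3//.
  move: e1; rewrite /Num.min; case: ifP => _ /eqP; rewrite normr_eq0 => /eqP e1.
    by rewrite [X in `|X + _|]e1 [X in `|X| + _]e1 normr0 !add0r normrM.
  by rewrite [X in a * X]e1 [X in `|a| * `|X|]e1 normr0 !mulr0 !addr0.
Qed.

(** The L^1 norm is additive on disjoint functions, so the L^1 norm of a linear
    combination is at least [c] times the sum of the moduli of its
    coefficients, which dominates its norm in the variable Lebesgue space. *)
Lemma disjoint_span_bounded_below (f : nat -> varL mu p) (c : R) : 0 <= c ->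
  (forall n, `|f n| = 1) ->
  (forall m n, m <> n -> varL_disjoint mu p (f m) (f n)) ->
  (forall n, c <= `|A (f n)|) ->
  forall x, linear_span f x -> c * `|x| <= `|A x|.
Proof.
move=> c0 f1 disj fc _ [n [a ->]].
apply: (@le_trans _ _ (c * \sum_(i < n) `|a i|)).
  rewrite ler_wpM2l//; apply: le_trans (ler_norm_sum _ _ _) _.
  by apply: ler_sum => i _; rewrite normrZ f1 mulr1.
have disjS k m : (k <= m)%N -> varL_disjoint mu p (\sum_(i < k) a i *: f i) (f m).
  elim: k => [|k IH] km; first by rewrite big_ord0; exact: varL_disjoint0.
  rewrite big_ord_recr/=; apply: varL_disjoint_lin.
    by apply: disj => e; rewrite e ltnn in km.
  exact/IH/ltnW.
elim: n => [|n IH]; first by rewrite !big_ord0 mulr0.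
rewrite !big_ord_recr/= inclusion_disjoint_norm; last exact: disjS.
by rewrite mulrDr lerD// mulrC ler_wpM2l.
Qed.

Lemma disjoint_normalized_not_dss (f : nat -> varL mu p) (c : R) : 0 < c ->
  (forall n, `|f n| = 1) ->
  (forall m n, m <> n -> varL_disjoint mu p (f m) (f n)) ->
  (forall n, c <= `|A (f n)|) ->
  ~ disjointly_strictly_singular (varL_disjoint mu p) A.
Proof.
move=> c0 f1 disj fc; apply; exists f; split; [exact: f1|exact: disj|].
apply: bounded_below_iso_onto_image.
- exact: inclusion_norm_le.
- exact: c0.
- by move=> x y; exact: linear_spanB.
- by move=> x; exact: (disjoint_span_bounded_below (ltW c0) f1 disj fc).
Qed.

End disjoint_sequences.

Lemma powR_le1_anti (R : realType) (b x y : R) : 0 < b -> b <= 1 -> x <= y ->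
  b `^ y <= b `^ x.
Proof.
move=> b0 b1 xy; rewrite /powR gt_eqF// ler_expR ler_wnM2r// ln_le0//.
Qed.

Section sublevel_indicators.
Context (d : measure_display) (T : measurableType d) (R : realType).
Variables (mu : {finite_measure set T -> \bar R}) (p : exponent T R).
Local Notation M := (fine (mu [set: T])).
Local Notation h := (fun t => p t / (p t - 1)).
Local Notation r := (fun t => (p t - 1) / p t).
Local Notation A := (inclusion mu p).
Hypothesis p_gt1 : {ae mu, forall t, 1 < p t}.

Let B (s : R) : set T := [set t | r t <= s].
Let b (s : R) : R := fine (mu (B s)).

Let mB s : measurable (B s).
Proof.
rewrite (_ : B s = ~` [set t | s < `|r t|]).
  by apply/measurableC/measurable_level; exact: measurable_conj_inv.
apply/seteqP; split => t /=; rewrite ger0_norm ?conj_inv_ge0// /B/= leNgt.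
  by move/negP.
by move=> /negP.
Qed.

Let bE s : mu (B s) = (b s)%:E.
Proof. by rewrite fineK// fin_num_measure. Qed.

Let le_b s s' : s <= s' -> b s <= b s'.
Proof.
move=> ss; rewrite -lee_fin -!bE; apply: le_measure; rewrite ?inE//.
by move=> t; rewrite /B/= => /le_trans; apply.
Qed.

Let b_distribution s : b s = M - fine (distribution_function mu r s).
Proof.
have mL := measurable_level (measurable_conj_inv p) s.
have BE : B s = ~` [set t | s < `|r t|].
  apply/seteqP; split => t /=; rewrite ger0_norm ?conj_inv_ge0// /B/= leNgt => /negP//.
rewrite /b BE -setTD measureD// ?setTI ?ltey_eq ?fin_num_measure//.
by rewrite fineB ?fin_num_measure.
Qed.

(** [r] is positive almost everywhere because [p > 1] is; its small sublevel
    sets lie in the large superlevel sets of [h = 1/r], up to a null set. *)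
Lemma sublevel_vanish (e : R) : 0 < e ->
  exists s : R, [/\ 0 < s, s < 1 & b s < e].
Proof.
move=> e0; have [s0 hs0] := conj_levels_vanish mu p e0.
pose s := (`|s0| + 2)^-1.
have s2 : 0 < `|s0| + 2 by rewrite ltr_wpDl.
exists s; split; first by rewrite invr_gt0.
  by rewrite invf_lt1// ltr_wpDl// ltr1n.
pose N := ~` [set t | 1 < p t].
have mh : measurable [set t | s0 < h t].
  rewrite (_ : [set t | _] = [set t | s0 < `|h t|]).
    by apply: measurable_level; exact: measurable_conj.
  by apply/seteqP; split => t /=; rewrite ger0_norm ?conj_ge0.
have mN : measurable N.
  apply: measurableC; rewrite (_ : [set t | _] = p @^-1` `]1, +oo[).
    by rewrite -[X in measurable X]setTI; exact: measurable_expo.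
  by apply/seteqP; split => t /=; rewrite in_itv/= andbT.
have N0 : mu N = 0%E by apply/(measure_negligible mN).
rewrite -lte_fin -bE; apply: le_lt_trans (hs0 s0 (lexx _)).
rewrite -(measureU0 mh mN N0); apply: le_measure; rewrite ?inE//.
  exact: measurableU.
move=> t; rewrite /B/= => rs; have [p1|p1] := ltP 1 (p t); last first.
  by right; rewrite /N/= ltNge p1.
left; have q0 : 0 < p t - 1 by rewrite subr_gt0.
have p0 : 0 < p t := expo_gt0 p t.
rewrite /= -invf_div; have r0 : 0 < r t by rewrite divr_gt0.
apply: (@lt_le_trans _ _ (`|s0| + 2)).
  by rewrite (le_lt_trans (ler_norm _))// ltrDl.
by rewrite -[leLHS]invrK lef_pV2 ?posrE ?invr_gt0.
Qed.

(** On the sublevel set [r <= s] the exponent is at most [1/(1 - s)]. If [m] is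
    the measure of that set and [m <= 1], an indicator supported in it has
    Luxemburg norm at most [m ^ (1 - s)], as for the indicator of a set of
    measure [m] in the space L^q with [q = 1/(1 - s)]. *)
Lemma luxemburg_indic_le (s : R) (D : set T) : 0 <= s -> s < 1 -> b s <= 1 ->
  0 < b s -> measurable D -> D `<=` B s ->
  varLfun mu p (\1_D) /\ luxemburg mu p (\1_D) <= b s / b s `^ s.
Proof.
move=> s0 s1 b1 b0 mD DB.
pose l := b s / b s `^ s.
have bs0 : 0 < b s `^ s by rewrite powR_gt0.
have l0 : 0 < l by rewrite divr_gt0.
have lE : l = b s `^ (1 - s).
  rewrite /l powRD; last by rewrite (gt_eqF b0) implybT.
  by rewrite powRr1 ?ltW// powRN.
have mod1 : (modular mu p (fun t => \1_D t / l)%R <= 1)%E.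
  have mi : measurable_fun setT (\1_D : T -> R) by exact: measurable_indic.
  apply: (@le_trans _ _ (\int[mu]_t ((b s)^-1%:E * (\1_D t)%:E))%E).
    apply: ge0_le_integral => //.
    - apply: measurable_modular; exact: measurable_funZ.
    - by apply: emeasurable_funM => //; exact/measurable_EFinP.
    move=> t _; rewrite indicE; have [tD|tD] := boolP (t \in D); last first.
      by rewrite mul0r normr0 powR0 ?mule0// gt_eqF// expo_gt0.
    rewrite mul1r mule1 gtr0_norm ?invr_gt0// lee_fin.
    have p0 := expo_gt0 p t.
    have -> : l^-1 `^ p t = (l `^ p t)^-1.
      by rewrite -(powR_inv1 (ltW l0)) -powRrM mulN1r powRN.
    rewrite lef_pV2 ?posrE ?powR_gt0//.
    rewrite lE -powRrM.
    apply: (@le_trans _ _ (b s `^ 1)); first by rewrite powRr1// ltW.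
    apply: powR_le1_anti => //.
    have := DB _ (set_mem tD); rewrite /B/= ler_pdivrMr// => rs.
    by rewrite mulrBl mul1r lerBlDr -lerBlDl.
  rewrite ge0_integralZl_EFin//; last 2 first.
  - exact/measurable_EFinP.
  - by rewrite invr_ge0 ltW.
  rewrite integral_indic// setIT -[X in (_ <= X)%E](_ : (b s)^-1%:E * mu (B s) = 1)%E; last first.
    by rewrite bE -EFinM mulVf// gt_eqF.
  apply: lee_wpmul2l; first by rewrite lee_fin invr_ge0 ltW.
  by apply: le_measure; rewrite ?inE.
split.
  split; first exact: measurable_indic.
  by exists l; [exact: l0|exact: le_lt_trans mod1 (ltry _)].
apply: (ge_inf (luxemburg_set_lbound mu p (\1_D))).
by split; [exact: l0|exact: mod1].
Qed.

(** If (4) fails along [x -> M], then [s], the value at [x] of the rearrangement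
    of [r], tends to 0: [(M - x) ^ s] stays above [eps] while [M - x] tends
    to 0. The sublevel set [r <= s] has measure at least [M - x], so this
    measure to the power [s] is at least [eps] as well. *)
Lemma sublevel_witness (eps : R) : 0 < eps ->
  (forall dl : R, 0 < dl -> exists x, [/\ 0 <= x, x < M, M - x < dl &
     eps <= (M - x) `^ fine (decreasing_rearrangement mu r x)]) ->
  forall e : R, 0 < e -> exists s : R,
    [/\ [/\ 0 <= s, s < 1 & b s <= 1], 0 < b s, b s < e & eps <= b s `^ s].
Proof.
move=> eps0 H e e0.
have e1 : 0 < Num.min e 1 by rewrite lt_min e0 ltr01.
have [sg [sg0 sg1]] := sublevel_vanish e1.
rewrite lt_min => /andP[be b1].
(* [M - x < eps ^ (1 / sg)] is what forces the level [s] below [sg]. *)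
have d0 : 0 < Num.min 1 (eps `^ sg^-1) by rewrite lt_min ltr01 powR_gt0.
have [x [x0 xM]] := H _ d0; rewrite lt_min => /andP[m1 meps].
have rfin := conj_inv_rearrangement_fin mu p x0.
set s := fine (decreasing_rearrangement _ _ _) => epsm.
have m0 : 0 < M - x by rewrite subr_gt0.
have s0 : 0 <= s by rewrite fine_ge0// decreasing_rearrangement_ge0.
have ssg : s < sg.
  rewrite ltNge; apply/negP => sgs.
  have := le_trans epsm (powR_le1_anti m0 (ltW m1) sgs).
  apply/negP; rewrite -ltNge.
  have := @gt0_ltr_powR R sg sg0 (M - x) (eps `^ sg^-1).
  rewrite !nnegrE powR_ge0 (ltW m0) => /(_ isT isT meps).
  by rewrite -powRrM mulVf ?gt_eqF// powRr1// ltW.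
have mb : M - x <= b s.
  rewrite b_distribution lerD2l lerN2 -lee_fin fineK; last first.
    by apply: distribution_function_fin; exact: measurable_conj_inv.
  rewrite leNgt -(lt_decreasing_rearrangement _ (measurable_conj_inv p))//.
  by rewrite -leNgt /s fineK.
have bsg : b s <= b sg by exact/le_b/ltW.
exists s; split.
- by split => //; [exact: lt_trans sg1|apply: le_trans bsg (ltW b1)].
- exact: lt_le_trans mb.
- exact: le_lt_trans be.
- by apply: le_trans epsm _; rewrite ge0_ler_powR ?nnegrE ?(ltW m0)// (le_trans (ltW m0)).
Qed.

(** A sequence of such levels along which the measures at least halve. The
    differences of consecutive sublevel sets are disjoint and keep half of the
    measure, so their indicators have comparable norms in the two spaces. *)
Lemma disjoint_sublevels (eps : R) : 0 < eps ->
  (forall e : R, 0 < e -> exists s : R,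
    [/\ [/\ 0 <= s, s < 1 & b s <= 1], 0 < b s, b s < e & eps <= b s `^ s]) ->
  exists D : nat -> set T, [/\ forall n, measurable (D n),
    forall m n, m <> n -> D m `&` D n = set0 &
    forall n, [/\ 0 < fine (mu (D n)), varLfun mu p (\1_(D n)) &
      luxemburg mu p (\1_(D n)) <= 2 / eps * fine (mu (D n))] ].
Proof.
move=> eps0 H.
have S_ex (e : R) : exists s : R, 0 < e ->
    [/\ [/\ 0 <= s, s < 1 & b s <= 1], 0 < b s, b s < e & eps <= b s `^ s].
  have [e0|e0] := ltP 0 e; last by exists 0.
  by have [s Hs] := H _ e0; exists s.
have [S SP] := choice S_ex.
pose s n := iter n (fun u => S (b u / 2)) (S 1).
have sP n : [/\ [/\ 0 <= s n, s n < 1 & b (s n) <= 1], 0 < b (s n) & eps <= b (s n) `^ s n].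
  elim: n => [|n [_ b0 _]]; first by have [h1 h2 _ h3] := SP 1 ltr01.
  by have [h1 h2 _ h3] := SP _ (divr_gt0 b0 (ltr0n R 2)).
have sS n : b (s n.+1) < b (s n) / 2.
  have [_ b0 _] := sP n.
  by have [_ _ h2 _] := SP _ (divr_gt0 b0 (ltr0n R 2)).
have s_dec n : s n.+1 <= s n.
  rewrite leNgt; apply/negP => /ltW/le_b; rewrite leNgt => /negP; apply.
  apply: lt_le_trans (sS n) _; have [_ b0 _] := sP n.
  by rewrite ler_pdivrMr// ler_pMr// ler1n.
have s_mono m n : (m <= n)%N -> s n <= s m.
  elim: n => [|n IH]; first by rewrite leqn0 => /eqP ->.
  rewrite leq_eqVlt => /predU1P[->//|/IH]; exact: le_trans.
pose D n := B (s n) `\` B (s n.+1).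
have mD n : measurable (D n) by exact: measurableD.
have sub n : B (s n.+1) `<=` B (s n).
  by move=> t; rewrite /B/= => /le_trans; apply; exact: s_dec.
have muD n : fine (mu (D n)) = b (s n) - b (s n.+1).
  rewrite /D measureD ?ltey_eq ?fin_num_measure// (setIidr (@sub n)).
  by rewrite fineB ?fin_num_measure.
have muD2 n : b (s n) / 2 <= fine (mu (D n)).
  rewrite muD lerBrDl -lerBrDr; apply: le_trans (ltW (sS n)) _.
  by rewrite lerBrDr -splitr.
exists D; split => // [m n mn|n].
  wlog : m n mn / (m < n)%N => [hw|lt].
    have [lt|lt|//] := ltngtP m n; first exact: hw.
    by rewrite setIC; apply: hw => // e; exact: mn.
  rewrite -subset0 => t [[_ nB] [Bn _]]; apply: nB.
  exact: le_trans Bn (s_mono m.+1 n lt).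
have [[s0 s1 b1] b0 epsb] := sP n.
have [v l] := luxemburg_indic_le s0 s1 b1 b0 (mD n) (@subDsetl _ _ _).
split; [by apply: lt_le_trans (muD2 n); rewrite divr_gt0|exact: v|].
apply: le_trans l _; apply: (@le_trans _ _ (b (s n) / eps)).
  by rewrite ler_pM2l// lef_pV2// posrE powR_gt0.
rewrite mulrAC ler_pM2r ?invr_gt0//.
by rewrite -ler_pdivrMl// mulrC.
Qed.

Lemma normalized_indicators (c : R) (D : nat -> set T) :
  (forall n, measurable (D n)) -> (forall m n, m <> n -> D m `&` D n = set0) ->
  (forall n, [/\ 0 < fine (mu (D n)), varLfun mu p (\1_(D n)) &
     luxemburg mu p (\1_(D n)) <= c * fine (mu (D n))]) -> 0 < c ->
  exists f : nat -> varL mu p, [/\ forall n, `|f n| = 1,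
    forall m n, m <> n -> varL_disjoint mu p (f m) (f n) &
    forall n, c^-1 <= `|A (f n)| ].
Proof.
move=> mD dD HD c0.
have x_ex n : exists x : varL mu p, (x : T -> R) = \1_(D n) %[ae mu] /\
    `|x| = luxemburg mu p (\1_(D n)).
  have [_ v _] := HD n; have [x xE xn] := varL_class_ex v.
  by exists x; split; [exact: xE|exact: xn].
have [x xE] := choice x_ex.
have AxE n : `|A (x n)| = fine (mu (D n)).
  have mi : measurable_fun setT (\1_(D n) : T -> R) by exact: measurable_indic.
  rewrite L1_normRE (@ae_Rintegral _ _ _ mu _ (\1_(D n))) //.
  - by rewrite /Rintegral integral_indic// setIT.
  - by apply: measurableT_comp => //; exact: L1_measurable.
  - apply: filterS (xE n).1 => t /(_ I) e _.
    by rewrite [X in `|X|]e ger0_norm// indicE.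
have x0 n : 0 < `|x n|.
  rewrite normr_gt0; apply/eqP => x0; have [] := HD n.
  by rewrite -AxE x0 linear0 normr0 ltxx.
have [a aE] : exists a : nat -> R, forall n, a n = `|x n|^-1.
  by exists (fun n => `|x n|^-1).
exists (fun n => a n *: x n); split.
- by move=> n; rewrite normrZ aE gtr0_norm ?invr_gt0// mulVf// gt_eqF.
- move=> m n mn; rewrite /varL_disjoint.
  have hm := @ae_classZ _ _ _ mu (a m) (x m : {mfun_ mu, T >-> R}).
  have hn := @ae_classZ _ _ _ mu (a n) (x n : {mfun_ mu, T >-> R}).
  apply: filterS3 (filterI (xE m).1 (xE n).1) hm hn => t [em en] /(_ I) hm' /(_ I) hn'.
  rewrite [X in Num.min `|X|]hm' [X in Num.min _ `|X|]hn' (em I) (en I) !indicE.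
  have [tm|_] := boolP (t \in D m); last by rewrite mulr0 normr0 min_l.
  have [tn|_] := boolP (t \in D n); last by rewrite mulr0 normr0 min_r.
  by exfalso; rewrite -falseE -(in_set0 t) -(dD _ _ mn) in_setI tm tn.
- move=> n; rewrite linearZ normrZ aE gtr0_norm ?invr_gt0// AxE.
  have [_ _ l] := HD n; rewrite -(xE n).2 in l.
  by rewrite ler_pdivlMl// mulrC ler_pdivrMl.
Qed.

Lemma disjointly_strictly_singular_power_limit :
  disjointly_strictly_singular (varL_disjoint mu p) A ->
  (M - x) `^ fine (decreasing_rearrangement mu r x)
     @[x --> within `[0, M[ (nbhs M)] --> (0 : R).
Proof.
move=> dss; apply/cvgrPdist_lt => eps eps0; apply: contrapT => nH.
have H (dl : R) : 0 < dl -> exists x, [/\ 0 <= x, x < M, M - x < dl &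
     eps <= (M - x) `^ fine (decreasing_rearrangement mu r x)].
  move=> dl0; apply: contrapT => nx; apply: nH; exists dl => // x /= Mx.
  rewrite in_itv/= => /andP[x0 xM]; rewrite sub0r normrN ger0_norm ?powR_ge0//.
  rewrite ltNge; apply/negP => le; apply: nx; exists x; split => //.
  by apply: le_lt_trans Mx; exact: ler_norm.
have [D [mD dD HD]] := disjoint_sublevels eps0 (sublevel_witness eps0 H).
have c0 : 0 < 2 / eps by rewrite divr_gt0.
have [f [f1 fd fc]] := normalized_indicators mD dD HD c0.
have c1 : 0 < (2 / eps)^-1 by rewrite invr_gt0.
exact: (disjoint_normalized_not_dss c1 f1 fd fc dss).
Qed.

End sublevel_indicators.

(** * The equivalence *)

Theorem corollary4p2 (d : measure_display) (T : measurableType d)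
    (R : realType) (mu : {finite_measure set T -> \bar R}) (p : exponent T R)
    (mu_atomless : atomless mu) (p_gt1 : {ae mu, forall t, 1 < p t}) :
  let M : R := fine (mu [set: T]) in
  [<-> forall a : R, 1 < a ->
         (\int[lebesgue_measure]_(x in `[0%R, M[)
            powRe a (decreasing_rearrangement mu
                       (fun t => (p t / (p t - 1))%R) x) < +oo)%E;
       weakly_compact (inclusion mu p);
       disjointly_strictly_singular (varL_disjoint mu p) (inclusion mu p);
       (M - x) `^ fine (decreasing_rearrangement mu
                          (fun t => (p t - 1) / p t) x)
         @[x --> within `[0, M[ (nbhs M)] --> (0 : R) ].
Proof.
move=> M; have mh := measurable_conj p; have h0 := conj_ge0 p.
tfae.
- move=> int_star; apply: exponential_integrability_weakly_compact => // a a1.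
  apply/(integral_powR_layers mu mh h0 a1).
  by apply/(integral_powRe_rearrangement mu mh h0 a1); exact: int_star.
- exact: weakly_compact_disjointly_strictly_singular.
- exact: disjointly_strictly_singular_power_limit.
- exact: power_limit_exponential_integrability.
Qed.
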